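(* Let $S$ be a finite set of places of $\mathbb Q$ containing $B=\{2,\infty\}$ and let $S_0=S\setminus B$. Let $\Gamma'_S\subseteq\Lambda_S$ be the subgroup generated by all $PA'_p$, $p\in S_0$. (1) Every element of $\Gamma'_S$ has a representative in the Lipschitz order $\mathcal A_L$ that is congruent to $1$ or to $1+j+k$ modulo $2\mathcal A_L$. (2) The action of $\Gamma'_S$ on $\mathbf T_{S_0}$ is simply transitive on the vertices and has no fixed cells (no non-trivial element maps a cell to itself). In particular, $\Gamma'_S$ is torsion-free.
   Context: Let $D=\mathbb Q\{i,j\}/(i^2=j^2=-1,\ ji=-ij)$ be the Hamilton quaternion algebra over $\mathbb Q$, $k=ij$, $\rho=\frac12(1+i+j+k)$; it is ramified exactly at $B=\{2,\infty\}$. Let $\mathcal A=\mathbb Z\oplus\mathbb Zi\oplus\mathbb Zj\oplus\mathbb Z\rho$ (Hurwitz order) and $\mathcal A_L=\mathbb Z\oplus\mathbb Zi\oplus\mathbb Zj\oplus\mathbb Zk$ (Lipschitz order). $\mathrm{Nrd}$ is the reduced norm. For a finite set $S\supseteq B$ of places let $\mathbb Z_S$ be the localisation of $\mathbb Z$ inverting the primes in $S$, and $\Lambda_S=(\mathcal A\otimes\mathbb Z_S)^\times/\mathbb Z_S^\times$; $[x]$ denotes the class of $x$. Let $\mathcal D_2=D\otimes_{\mathbb Q}\mathbb Q_2$ (a skew field), $\mathfrak O_{D,2}$ its maximal order, $\mathfrak m_2$ its maximal ideal, and $U^2=1+\mathfrak m_2^2=1+2\mathfrak O_{D,2}$. For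 an odd prime $p$ let $A_p$ be the set of $x\in\mathcal A$ with $\mathrm{Nrd}(x)=p$ whose image in $\mathcal D_2^\times/(\mathbb Q_2^\times\cdot U^2)$ is trivial. Put $A'_p=A_p$ if $p\equiv1\bmod4$ and $A'_p=A_p\,i=\{xi:x\in A_p\}$ if $p\equiv3\bmod4$, and let $PA'_p$ be the image of $A'_p$ in $\Lambda_{\{2,\infty,p\}}\subseteq\Lambda_S$ (for $p\in S_0$). For $p\in S_0$ let $\mathrm T_{p+1}$ be the Bruhat–Tits tree of $(D\otimes\mathbb Q_p)^\times/\mathbb Q_p^\times\simeq\mathrm{PGL}_2(\mathbb Q_p)$, a $(p+1)$-regular tree. $\Lambda_S$ acts on the cube complex $\mathbf T_{S_0}=\prod_{p\in S_0}\mathrm T_{p+1}$ via $\Lambda_S\hookrightarrow\prod_{p\in S_0}\mathrm{PGL}_2(\mathbb Q_p)$. *)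

(* Defs.v *)
From HB Require Import structures.
From mathcomp Require Import all_boot all_order all_algebra ring zify.
From mathcomp Require Import generic_quotient finmap.
From mathcomp Require Import boolp classical_sets functions.

Set Implicit Arguments.
Unset Strict Implicit.
Unset Printing Implicit Defensive.

Import Order.TTheory GRing.Theory Num.Theory.
Local Open Scope classical_set_scope.
Local Open Scope ring_scope.

Definition prime_nat := {p : nat | prime p}.
Definition nat_of_prime (p : prime_nat) : nat := val p.
Coercion nat_of_prime : prime_nat >-> nat.

Definition prime2 : prime_nat := exist (fun p => prime p) 2%N isT.

(** [Some p] is the p-adic place, [None] is the archimedean one. *)
Definition place := option prime_nat.
Definition infty : place := None.
Definition fin_place (p : prime_nat) : place := Some p.

Definition ramified_places : {fset place} := [fset fin_place prime2; infty]%fset.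

Definition S0_prime (S : {fset place}) :=
  {p : prime_nat | fin_place p \in (S `\` ramified_places)%fset}.

(** Z_p is the inverse limit of the rings Z/p^n; the n-th component is stored
    as its representative in [0, p^n[. *)
Definition coherent (p : prime_nat) (x : nat -> int) : Prop :=
  forall n, x n = (x n.+1 %% (p%:Z ^+ n))%Z.

Definition padic_int (p : prime_nat) := {x : nat -> int | `[< coherent p x >]}.

HB.instance Definition _ p := Choice.on (padic_int p).

Lemma modz_dvdm (d e m : int) :
  (d %| e)%Z -> ((m %% e)%Z %% d)%Z = (m %% d)%Z.
Proof.
move=> de; apply/eqP; rewrite eqz_mod_dvd -rpredN opprB {1}(divz_eq m e) addrK.
exact: dvdz_mull.
Qed.

Section PadicInt.
Variable p : prime_nat.
Local Notation Zp := (padic_int p).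
Local Notation q := (p%:Z).
Implicit Types x y z : Zp.

Lemma p_prime : prime p. Proof. exact: (valP p). Qed.
Lemma p_gt0 : (0 < p)%N. Proof. exact: prime_gt0 p_prime. Qed.
Lemma p_gt1 : (1 < p)%N. Proof. exact: prime_gt1 p_prime. Qed.

Definition padic_comp x n : int := val x n.

Lemma padic_compE x n : padic_comp x n = (padic_comp x n.+1 %% q ^+ n)%Z.
Proof. by have /asboolP := valP x. Qed.

Lemma padic_compP x y : (forall n, padic_comp x n = padic_comp y n) -> x = y.
Proof. by move=> e; apply/val_inj/funext. Qed.

Lemma padic_mod x n : (padic_comp x n %% q ^+ n)%Z = padic_comp x n.
Proof. by rewrite padic_compE modz_mod. Qed.

Lemma padic_le x m n :
  (m <= n)%N -> (padic_comp x n %% q ^+ m)%Z = padic_comp x m.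
Proof.
move=> /subnK <-; elim: (n - m)%N => [|k IH]; first exact: padic_mod.
rewrite -[RHS]IH addSn [in RHS]padic_compE modz_dvdm //.
by rewrite exprD dvdz_mull.
Qed.

Definition compatible (f : nat -> int) : Prop :=
  forall n, (f n.+1 = f n %[mod q ^+ n])%Z.

Lemma padic_of_subproof f : compatible f ->
  `[< coherent p (fun n => (f n %% q ^+ n)%Z) >].
Proof.
move=> cf; apply/asboolP => n.
by rewrite modz_dvdm ?exprS ?dvdz_mull // cf.
Qed.

Definition padic_of f (cf : compatible f) : Zp :=
  exist (fun s => `[< coherent p s >]) _ (padic_of_subproof cf).

Lemma padic_ofE f (cf : compatible f) n :
  padic_comp (padic_of cf) n = (f n %% q ^+ n)%Z.
Proof. by []. Qed.

Lemma padic_comp_compat x : compatible (padic_comp x).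
Proof. by move=> n; rewrite -padic_compE padic_mod. Qed.

Lemma padic_const_compat a : compatible (fun=> a). Proof. by []. Qed.

Lemma padic_add_compat x y :
  compatible (fun n => padic_comp x n + padic_comp y n).
Proof. by move=> n; rewrite -modzDm !padic_comp_compat modzDm. Qed.

Lemma padic_mul_compat x y :
  compatible (fun n => padic_comp x n * padic_comp y n).
Proof. by move=> n; rewrite -modzMm !padic_comp_compat modzMm. Qed.

Lemma padic_opp_compat x : compatible (fun n => - padic_comp x n).
Proof. by move=> n; rewrite -modzNm padic_comp_compat modzNm. Qed.

Definition padic_add x y := padic_of (padic_add_compat x y).
Definition padic_mul x y := padic_of (padic_mul_compat x y).
Definition padic_opp x := padic_of (padic_opp_compat x).
Definition padic_zero : Zp := padic_of (padic_const_compat 0).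
Definition padic_one : Zp := padic_of (padic_const_compat 1).

Fact padic_addA : associative padic_add.
Proof.
move=> x y z; apply: padic_compP => n; rewrite !padic_ofE.
by rewrite modzDmr modzDml addrA.
Qed.

Fact padic_addC : commutative padic_add.
Proof. by move=> x y; apply: padic_compP => n; rewrite !padic_ofE addrC. Qed.

Fact padic_add0 : left_id padic_zero padic_add.
Proof.
by move=> x; apply: padic_compP => n; rewrite !padic_ofE modzDml add0r padic_mod.
Qed.

Fact padic_addN : left_inverse padic_zero padic_opp padic_add.
Proof.
by move=> x; apply: padic_compP => n; rewrite !padic_ofE modzDml addNr.
Qed.

HB.instance Definition _ := GRing.isZmodule.Build Zp
  padic_addA padic_addC padic_add0 padic_addN.

Fact padic_mulA : associative padic_mul.
Proof.
move=> x y z; apply: padic_compP => n; rewrite !padic_ofE.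
by rewrite modzMmr modzMml mulrA.
Qed.

Fact padic_mulC : commutative padic_mul.
Proof. by move=> x y; apply: padic_compP => n; rewrite !padic_ofE mulrC. Qed.

Fact padic_mul1 : left_id padic_one padic_mul.
Proof.
by move=> x; apply: padic_compP => n; rewrite !padic_ofE modzMml mul1r padic_mod.
Qed.

Fact padic_mulDl : left_distributive padic_mul padic_add.
Proof.
move=> x y z; apply: padic_compP => n; rewrite !padic_ofE.
by rewrite modzMml modzDml modzDmr mulrDl.
Qed.

Fact padic_one_neq0 : padic_one != padic_zero.
Proof.
apply/eqP => /(congr1 (fun x => padic_comp x 1)); rewrite !padic_ofE mod0z.
by rewrite expr1 modz_small ?ltz_nat ?p_gt1.
Qed.

HB.instance Definition _ := GRing.Zmodule_isComNzRing.Build Zp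
  padic_mulA padic_mulC padic_mul1 padic_mulDl padic_one_neq0.

Definition padic_unit : {pred Zp} := fun x => `[< exists y, y * x = 1 >].

Definition padic_inv x : Zp :=
  if pselect (exists y, y * x = 1) is left e then projT1 (cid e) else x.

Fact padic_mulVx : {in padic_unit, left_inverse 1 padic_inv *%R}.
Proof.
move=> x /asboolP ux; rewrite /padic_inv; case: pselect => // e.
exact: projT2 (cid e).
Qed.

Fact padic_unitPl x y : y * x = 1 -> padic_unit x.
Proof. by move=> e; apply/asboolP; exists y. Qed.

Fact padic_invr_out : {in [predC padic_unit], padic_inv =1 id}.
Proof.
by move=> x /asboolPn ux; rewrite /padic_inv; case: pselect.
Qed.

HB.instance Definition _ := GRing.ComNzRing_hasMulInverse.Build Zp
  padic_mulVx padic_unitPl padic_invr_out.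

Lemma padic_neq0 x : x != 0 -> exists n, ~~ (q ^+ n %| padic_comp x n)%Z.
Proof.
move=> nx; apply: contrapT => /forallNP h; case/eqP: nx.
apply: padic_compP => n; rewrite [RHS]padic_ofE mod0z -padic_mod.
by apply/dvdz_mod0P/negPn/negP.
Qed.

Lemma dvdz_pfactor (n : nat) (a : int) :
  (q ^+ n %| a)%Z = (p ^ n %| `|a|)%N.
Proof. by rewrite /dvdz /in_mem /= abszX. Qed.

Fact padic_integral : GRing.integral_domain_axiom Zp.
Proof.
move=> x y xy0; apply: contraT; rewrite negb_or => /andP[nx ny].
have [m hm] := padic_neq0 nx; have [n hn] := padic_neq0 ny.
have := congr1 (fun z => padic_comp z (m + n)) xy0.
rewrite !padic_ofE mod0z => /dvdz_mod0P.
set a := padic_comp x _; set b := padic_comp y _.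
have ha : ~~ (q ^+ m %| a)%Z.
  apply: contra hm => /dvdz_mod0P; rewrite /a padic_le ?leq_addr // => ->.
  exact: dvdz0.
have hb : ~~ (q ^+ n %| b)%Z.
  apply: contra hn => /dvdz_mod0P; rewrite /b padic_le ?leq_addl // => ->.
  exact: dvdz0.
have na : (0 < `|a|)%N.
  by rewrite lt0n absz_eq0; apply: contra ha => /eqP ->; rewrite dvdz0.
have nb : (0 < `|b|)%N.
  by rewrite lt0n absz_eq0; apply: contra hb => /eqP ->; rewrite dvdz0.
rewrite !dvdz_pfactor abszM in ha hb *.
rewrite !pfactor_dvdn ?p_prime ?muln_gt0 ?na ?nb // in ha hb *.
rewrite lognM // -!ltnNge in ha hb *.
by lia.
Qed.

HB.instance Definition _ := GRing.ComUnitRing_isIntegral.Build Zp padic_integral.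

End PadicInt.

Notation Qp p := {fraction padic_int p}.

Section QpChar0.
Variable p : prime_nat.

Lemma padic_nat_comp (n m : nat) :
  padic_comp (n%:R : padic_int p) m = (n%:Z %% p%:Z ^+ m)%Z.
Proof.
elim: n => [|n IH]; first by [].
by rewrite -natr1 padic_ofE IH modzDml modzDmr -PoszD addn1.
Qed.

Lemma Qp_natr_eq0 (n : nat) : (n%:R == 0 :> Qp p) = (n == 0%N).
Proof.
have -> : n%:R = tofrac (n%:R : padic_int p) :> Qp p by rewrite rmorph_nat.
rewrite tofrac_eq0; apply/eqP/eqP => [e|->//].
have := congr1 (fun x => padic_comp x n) e.
rewrite padic_nat_comp -[0 in RHS]/(0%:R) padic_nat_comp mod0z modz_small //.
  by case.
by rewrite -[p%:Z]natz -natrX natz ltz_nat ltn_expl ?p_gt1.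
Qed.

Lemma Qp_intr_eq0 (n : int) : (n%:~R == 0 :> Qp p) = (n == 0).
Proof.
by case: n => n; rewrite ?NegzE ?mulrNz ?oppr_eq0 -pmulrn Qp_natr_eq0.
Qed.

Lemma ratr_QpE (a b : int) : b != 0 -> ratr (a%:~R / b%:~R) = a%:~R / b%:~R :> Qp p.
Proof.
move=> b0; set x := a%:~R / b%:~R; rewrite /ratr.
apply/eqP; rewrite eqr_div ?Qp_intr_eq0 ?denq_neq0 // -!intrM.
suff -> : numq x * b = a * denq x by [].
apply: (@intr_inj rat); rewrite !intrM.
by apply/eqP; rewrite -eqr_div ?intr_eq0 ?denq_neq0 // divq_num_den.
Qed.

Lemma ratr_QpM (x y : rat) : ratr (x * y) = ratr x * ratr y :> Qp p.
Proof.
rewrite -[x]divq_num_den -[y]divq_num_den mulf_div -!intrM.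
by rewrite !ratr_QpE ?mulf_neq0 ?denq_neq0 // mulf_div !intrM.
Qed.

Lemma ratr_Qp_eq0 (x : rat) : (ratr x == 0 :> Qp p) = (x == 0).
Proof.
by rewrite mulf_eq0 invr_eq0 !Qp_intr_eq0 (negPf (denq_neq0 x)) orbF numq_eq0.
Qed.

End QpChar0.

(** [quat K] is the base change to K of the quaternion algebra
    Q{i, j}/(i^2 = j^2 = -1, ji = -ij), with basis 1, i, j, k = ij. *)

Record quat (R : Type) := Quat { q_re : R; q_i : R; q_j : R; q_k : R }.

Section QuatChoice.
Variable R : choiceType.
Definition quat_to_prod (x : quat R) := (q_re x, q_i x, q_j x, q_k x).
Definition prod_to_quat (t : R * R * R * R) : quat R :=
  let: (a, b, c, d) := t in Quat a b c d.
Lemma quat_to_prodK : cancel quat_to_prod prod_to_quat. Proof. by case. Qed.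
HB.instance Definition _ := Choice.copy (quat R) (can_type quat_to_prodK).
End QuatChoice.

Section QuatRing.
Variable R : comNzRingType.
Implicit Types x y z : quat R.

Definition quat_add x y :=
  Quat (q_re x + q_re y) (q_i x + q_i y) (q_j x + q_j y) (q_k x + q_k y).
Definition quat_opp x := Quat (- q_re x) (- q_i x) (- q_j x) (- q_k x).
Definition quat_mul x y :=
  Quat (q_re x * q_re y - q_i x * q_i y - q_j x * q_j y - q_k x * q_k y)
       (q_re x * q_i y + q_i x * q_re y + q_j x * q_k y - q_k x * q_j y)
       (q_re x * q_j y - q_i x * q_k y + q_j x * q_re y + q_k x * q_i y)
       (q_re x * q_k y + q_i x * q_j y - q_j x * q_i y + q_k x * q_re y).
Definition quat_scale (a : R) x :=
  Quat (a * q_re x) (a * q_i x) (a * q_j x) (a * q_k x).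

Fact quat_addA : associative quat_add.
Proof. by move=> [? ? ? ?] [? ? ? ?] [? ? ? ?]; congr Quat; apply: addrA. Qed.
Fact quat_addC : commutative quat_add.
Proof. by move=> [? ? ? ?] [? ? ? ?]; congr Quat; apply: addrC. Qed.
Fact quat_add0 : left_id (Quat 0 0 0 0) quat_add.
Proof. by move=> [? ? ? ?]; congr Quat; apply: add0r. Qed.
Fact quat_addN : left_inverse (Quat 0 0 0 0) quat_opp quat_add.
Proof. by move=> [? ? ? ?]; congr Quat; apply: addNr. Qed.

HB.instance Definition _ := GRing.isZmodule.Build (quat R)
  quat_addA quat_addC quat_add0 quat_addN.

Fact quat_mulA : associative quat_mul.
Proof.
by move=> [? ? ? ?] [? ? ? ?] [? ? ? ?]; rewrite /quat_mul /=; congr Quat; ring.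
Qed.
Fact quat_mul1l : left_id (Quat 1 0 0 0) quat_mul.
Proof. by move=> [? ? ? ?]; rewrite /quat_mul /=; congr Quat; ring. Qed.
Fact quat_mul1r : right_id (Quat 1 0 0 0) quat_mul.
Proof. by move=> [? ? ? ?]; rewrite /quat_mul /=; congr Quat; ring. Qed.
Fact quat_mulDl : left_distributive quat_mul quat_add.
Proof.
by move=> [? ? ? ?] [? ? ? ?] [? ? ? ?]; rewrite /quat_mul /quat_add /=;
   congr Quat; ring.
Qed.
Fact quat_mulDr : right_distributive quat_mul quat_add.
Proof.
by move=> [? ? ? ?] [? ? ? ?] [? ? ? ?]; rewrite /quat_mul /quat_add /=;
   congr Quat; ring.
Qed.
Fact quat_one_neq0 : Quat 1 0 0 0 != 0 :> quat R.
Proof. by apply/eqP => -[] /eqP; rewrite oner_eq0. Qed.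

HB.instance Definition _ := GRing.Zmodule_isNzRing.Build (quat R)
  quat_mulA quat_mul1l quat_mul1r quat_mulDl quat_mulDr quat_one_neq0.

Fact quat_scaleA a b x : quat_scale a (quat_scale b x) = quat_scale (a * b) x.
Proof. by case: x => *; congr Quat; apply: mulrA. Qed.
Fact quat_scale1 : left_id 1 quat_scale.
Proof. by move=> [? ? ? ?]; congr Quat; apply: mul1r. Qed.
Fact quat_scaleDr : right_distributive quat_scale +%R.
Proof. by move=> a [? ? ? ?] [? ? ? ?]; congr Quat; apply: mulrDr. Qed.
Fact quat_scaleDl x : {morph quat_scale^~ x : a b / a + b}.
Proof. by move=> a b; case: x => *; congr Quat; apply: mulrDl. Qed.

HB.instance Definition _ := GRing.Zmodule_isLmodule.Build R (quat R)
  quat_scaleA quat_scale1 quat_scaleDr quat_scaleDl.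

Fact quat_scaleAl (a : R) x y : a *: (x * y) = (a *: x) * y.
Proof.
case: x y => ? ? ? ? [? ? ? ?].
by rewrite /GRing.scale /GRing.mul /= /quat_scale /quat_mul /=; congr Quat; ring.
Qed.
HB.instance Definition _ := GRing.Lmodule_isLalgebra.Build R (quat R)
  quat_scaleAl.

Fact quat_scaleAr (a : R) x y : a *: (x * y) = x * (a *: y).
Proof.
case: x y => ? ? ? ? [? ? ? ?].
by rewrite /GRing.scale /GRing.mul /= /quat_scale /quat_mul /=; congr Quat; ring.
Qed.
HB.instance Definition _ := GRing.Lalgebra_isAlgebra.Build R (quat R)
  quat_scaleAr.

Lemma quat1E : 1 = Quat 1 0 0 0 :> quat R. Proof. by []. Qed.
Lemma quatDE a b c d a' b' c' d' : Quat a b c d + Quat a' b' c' d' =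
  Quat (a + a') (b + b') (c + c') (d + d') :> quat R.
Proof. by []. Qed.
Lemma quatZE e a b c d :
  e *: Quat a b c d = Quat (e * a) (e * b) (e * c) (e * d) :> quat R.
Proof. by []. Qed.
Lemma quatME a b c d a' b' c' d' : Quat a b c d * Quat a' b' c' d' =
  Quat (a * a' - b * b' - c * c' - d * d') (a * b' + b * a' + c * d' - d * c')
       (a * c' - b * d' + c * a' + d * b') (a * d' + b * c' - c * b' + d * a')
  :> quat R.
Proof. by []. Qed.

Definition quat_conj x := Quat (q_re x) (- q_i x) (- q_j x) (- q_k x).

Definition Nrd x := q_re x ^+ 2 + q_i x ^+ 2 + q_j x ^+ 2 + q_k x ^+ 2.

Lemma quat_conjM x : quat_conj x * x = (Nrd x)%:A.
Proof.
case: x => a b c d; rewrite /Nrd /quat_conj /=.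
by rewrite /GRing.scale /GRing.mul /= /quat_mul /quat_scale /=; congr Quat; ring.
Qed.

Lemma quat_mulconj x : x * quat_conj x = (Nrd x)%:A.
Proof.
case: x => a b c d; rewrite /Nrd /quat_conj /=.
by rewrite /GRing.scale /GRing.mul /= /quat_mul /quat_scale /=; congr Quat; ring.
Qed.

Lemma NrdM x y : Nrd (x * y) = Nrd x * Nrd y.
Proof. by case: x y => ? ? ? ? [? ? ? ?]; rewrite /Nrd /=; ring. Qed.

Lemma Nrd1 : Nrd 1 = 1.
Proof. by rewrite /Nrd /= expr1n !expr0n !addr0. Qed.

End QuatRing.

Section QuatUnit.
Variable R : comUnitRingType.

Definition quat_unit : {pred quat R} := fun x => Nrd x \is a GRing.unit.
Definition quat_inv (x : quat R) :=
  if quat_unit x then (Nrd x)^-1 *: quat_conj x else x.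

Fact quat_mulVx : {in quat_unit, left_inverse 1 quat_inv *%R}.
Proof.
move=> x ux; rewrite /quat_inv [quat_unit x]ux -scalerAl quat_conjM.
by rewrite scalerA mulVr // scale1r.
Qed.
Fact quat_mulxV : {in quat_unit, right_inverse 1 quat_inv *%R}.
Proof.
move=> x ux; rewrite /quat_inv [quat_unit x]ux -scalerAr quat_mulconj.
by rewrite scalerA mulVr // scale1r.
Qed.
Fact quat_unitP x y : y * x = 1 /\ x * y = 1 -> quat_unit x.
Proof.
case=> /(congr1 (@Nrd R)); rewrite NrdM Nrd1 => e _.
by apply/unitrPr; exists (Nrd y); rewrite mulrC.
Qed.
Fact quat_inv_out : {in [predC quat_unit], quat_inv =1 id}.
Proof. by move=> x /negPf ux; rewrite /quat_inv [quat_unit x]ux. Qed.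

HB.instance Definition _ := GRing.NzRing_hasMulInverse.Build (quat R)
  quat_mulVx quat_mulxV quat_unitP quat_inv_out.

End QuatUnit.

Notation D := (quat rat).

Definition D_i : D := Quat 0 1 0 0.
Definition D_j : D := Quat 0 0 1 0.
Definition D_k : D := Quat 0 0 0 1.
Definition D_rho : D := (1 / 2) *: (1 + D_i + D_j + D_k).

Definition hurwitz : set D :=
  [set x | exists a b c d : int,
     x = a%:~R + b%:~R * D_i + c%:~R * D_j + d%:~R * D_rho].

Definition lipschitz : set D :=
  [set x | exists a b c d : int,
     x = a%:~R + b%:~R * D_i + c%:~R * D_j + d%:~R * D_k].

Definition cong_mod_2lipschitz (x y : D) : Prop :=
  exists2 z, lipschitz z & x - y = 2 * z.

Section SArithmetic.
Variable S : {fset place}.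

(** The natural numbers all of whose prime factors lie in S. *)
Definition S_number (n : nat) : Prop :=
  (0 < n)%N /\ forall p : prime_nat, (p %| n)%N -> fin_place p \in S.

Definition ZS : set rat :=
  [set x | exists n m, S_number n /\ x = m%:~R / n%:R].

Definition hurwitzS : set D :=
  [set x | exists a b c d : rat, [/\ ZS a, ZS b, ZS c & ZS d] /\
     x = a%:A + b *: D_i + c *: D_j + d *: D_rho].

Lemma S_number1 : S_number 1.
Proof.
split=> // p; rewrite dvdn1 => /eqP e.
by have := prime_gt1 (valP p); rewrite -[val p]/(p : nat) e.
Qed.

Lemma S_numberM m n : S_number m -> S_number n -> S_number (m * n).
Proof.
move=> [m0 hm] [n0 hn]; split; first by rewrite muln_gt0 m0.
by move=> p; rewrite Euclid_dvdM ?(valP p) // => /orP[/hm|/hn].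
Qed.

Lemma ZS_int (m : int) : ZS m%:~R.
Proof. by exists 1%N, m; split; [exact: S_number1 | rewrite divr1]. Qed.

Lemma S_number_neq0 n : S_number n -> n%:R != 0 :> rat.
Proof. by case=> n0 _; rewrite pnatr_eq0 -lt0n. Qed.

Lemma ZSD x y : ZS x -> ZS y -> ZS (x + y).
Proof.
move=> [n [a [hn ->]]] [m [b [hm ->]]].
exists (n * m)%N, (a * m + b * n); split; first exact: S_numberM.
rewrite addf_div ?S_number_neq0 // natrM.
by rewrite rmorphD /= !rmorphM.
Qed.

Lemma ZSM x y : ZS x -> ZS y -> ZS (x * y).
Proof.
move=> [n [a [hn ->]]] [m [b [hm ->]]].
exists (n * m)%N, (a * b); split; first exact: S_numberM.
by rewrite mulf_div rmorphM natrM.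
Qed.

Lemma ZSN x : ZS x -> ZS (- x).
Proof.
by move=> [n [a [hn ->]]]; exists n, (- a); split; rewrite // rmorphN mulNr.
Qed.

Lemma hurwitzS1 : hurwitzS 1.
Proof.
exists 1, 0, 0, 0; split; last by rewrite !scale0r !addr0 scale1r.
by split; [exact: (ZS_int 1) | exact: (ZS_int 0)..].
Qed.

Lemma hurwitzSM x y : hurwitzS x -> hurwitzS y -> hurwitzS (x * y).
Proof.
move=> [a [b [c [d [[ha hb hc hd] ->]]]]] [e [f [g [h [[he hf hg hh] ->]]]]].
exists (a * e - b * f - c * g - b * g + c * f - b * h - d * g - d * h).
exists (a * f + b * e - b * g + c * f + d * f + c * h - d * g).
exists (a * g + c * e - b * g + c * f - b * h + d * f + c * h).
exists (a * h + d * e + (b * g + b * g) - (c * f + c * f)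
        + b * h - d * f - c * h + d * g + d * h).
split; first by split; repeat first [assumption | apply: ZSD | apply: ZSN | apply: ZSM].
rewrite /D_rho /D_i /D_j /D_k quat1E !(quatZE, quatDE, quatME).
by rewrite /=; congr Quat; field.
Qed.

Definition is_hurwitzS_unit (x : D) : Prop :=
  [/\ hurwitzS x, x \is a GRing.unit & hurwitzS x^-1].

Definition hurwitzS_unit := {x : D | `[< is_hurwitzS_unit x >]}.
HB.instance Definition _ := Choice.on hurwitzS_unit.

Lemma hurwitzS_unitP (u : hurwitzS_unit) : is_hurwitzS_unit (val u).
Proof. by have /asboolP := valP u. Qed.

Definition to_hurwitzS_unit x (hx : is_hurwitzS_unit x) : hurwitzS_unit :=
  exist (fun x => `[< is_hurwitzS_unit x >]) x (asboolT hx).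

Fact hurwitzS_unit_one_subproof : is_hurwitzS_unit 1.
Proof. by split; rewrite ?unitr1 ?invr1 //; exact: hurwitzS1. Qed.

Fact hurwitzS_unit_mul_subproof (u v : hurwitzS_unit) :
  is_hurwitzS_unit (val u * val v).
Proof.
have [hu uu iu] := hurwitzS_unitP u; have [hv uv iv] := hurwitzS_unitP v.
by split; rewrite ?unitrMl ?invrM //; exact: hurwitzSM.
Qed.

Fact hurwitzS_unit_inv_subproof (u : hurwitzS_unit) :
  is_hurwitzS_unit (val u)^-1.
Proof.
by have [hu uu iu] := hurwitzS_unitP u; split; rewrite ?unitrV ?invrK.
Qed.

Definition hurwitzS_unit_one := to_hurwitzS_unit hurwitzS_unit_one_subproof.
Definition hurwitzS_unit_mul u v :=
  to_hurwitzS_unit (hurwitzS_unit_mul_subproof u v).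
Definition hurwitzS_unit_inv u :=
  to_hurwitzS_unit (hurwitzS_unit_inv_subproof u).

Fact hurwitzS_unit_mulA : associative hurwitzS_unit_mul.
Proof. by move=> u v w; apply/val_inj/mulrA. Qed.
Fact hurwitzS_unit_mul1 : left_id hurwitzS_unit_one hurwitzS_unit_mul.
Proof. by move=> u; apply/val_inj/mul1r. Qed.
Fact hurwitzS_unit_mulr1 : right_id hurwitzS_unit_one hurwitzS_unit_mul.
Proof. by move=> u; apply/val_inj/mulr1. Qed.
Fact hurwitzS_unit_mulV :
  left_inverse hurwitzS_unit_one hurwitzS_unit_inv hurwitzS_unit_mul.
Proof.
by move=> u; apply/val_inj/mulVr; have [] := hurwitzS_unitP u.
Qed.
Fact hurwitzS_unit_mulrV :
  right_inverse hurwitzS_unit_one hurwitzS_unit_inv hurwitzS_unit_mul.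
Proof.
by move=> u; apply/val_inj/mulrV; have [] := hurwitzS_unitP u.
Qed.

HB.instance Definition _ := isGroup.Build hurwitzS_unit
  hurwitzS_unit_mulA hurwitzS_unit_mul1 hurwitzS_unit_mulr1
  hurwitzS_unit_mulV hurwitzS_unit_mulrV.

Definition ZS_unit : set rat := [set z | [/\ z != 0, ZS z & ZS z^-1]].

Lemma ZS_unit1 : ZS_unit 1.
Proof. by split; rewrite ?invr1 //; exact: (ZS_int 1). Qed.

Lemma ZS_unitM y z : ZS_unit y -> ZS_unit z -> ZS_unit (y * z).
Proof.
by move=> [y0 hy iy] [z0 hz iz]; split; rewrite ?mulf_neq0 ?invfM //; exact: ZSM.
Qed.

Lemma ZS_unitV z : ZS_unit z -> ZS_unit z^-1.
Proof. by move=> [z0 hz iz]; split; rewrite ?invr_neq0 ?invrK. Qed.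

Definition same_class (u v : hurwitzS_unit) : bool :=
  `[< exists2 z, ZS_unit z & val u = z *: val v >].

Fact same_class_refl : reflexive same_class.
Proof.
by move=> u; apply/asboolP; exists 1; [exact: ZS_unit1 | rewrite scale1r].
Qed.

Fact same_class_sym : symmetric same_class.
Proof.
suff h u v : same_class u v -> same_class v u by move=> u v; apply/idP/idP => /h.
move=> /asboolP[z hz e]; apply/asboolP; exists z^-1; first exact: ZS_unitV.
by case: hz => z0 _ _; rewrite e scalerA mulVf // scale1r.
Qed.

Fact same_class_trans : transitive same_class.
Proof.
move=> v u w /asboolP[y hy e] /asboolP[z hz f]; apply/asboolP; exists (y * z).
  exact: ZS_unitM.
by rewrite e f scalerA.
Qed.

Canonical same_class_equiv :=
  EquivRel same_class same_class_refl same_class_sym same_class_trans.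

Local Open Scope quotient_scope.

Definition Lambda := {eq_quot same_class_equiv}.
HB.instance Definition _ := Choice.on Lambda.
HB.instance Definition _ := EqQuotient.on Lambda.

Definition Lambda_class (u : hurwitzS_unit) : Lambda := \pi_Lambda u.

Lemma Lambda_classP u v :
  Lambda_class u = Lambda_class v <-> exists2 z, ZS_unit z & val u = z *: val v.
Proof. by split=> [/eqmodP/asboolP | h]; last by apply/eqmodP/asboolP. Qed.

Lemma repr_Lambda_class u :
  exists2 z, ZS_unit z & val (repr (Lambda_class u)) = z *: val u.
Proof. by apply/Lambda_classP; rewrite /Lambda_class reprK. Qed.

Definition Lambda_one : Lambda := Lambda_class 1%g.
Definition Lambda_mul (g h : Lambda) : Lambda :=
  Lambda_class (repr g * repr h)%g.
Definition Lambda_inv (g : Lambda) : Lambda := Lambda_class (repr g)^-1%g.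

Lemma Lambda_class1 : Lambda_class 1%g = Lambda_one. Proof. by []. Qed.

Lemma Lambda_classM u v :
  Lambda_mul (Lambda_class u) (Lambda_class v) = Lambda_class (u * v)%g.
Proof.
have [y hy ey] := repr_Lambda_class u; have [z hz ez] := repr_Lambda_class v.
apply/Lambda_classP; exists (y * z); first exact: ZS_unitM.
by rewrite /= ey ez -scalerAl -scalerAr scalerA.
Qed.

Lemma Lambda_classV u : Lambda_inv (Lambda_class u) = Lambda_class u^-1%g.
Proof.
have [z hz ez] := repr_Lambda_class u; apply/Lambda_classP.
exists z^-1; first exact: ZS_unitV.
have [z0 _ _] := hz; have [_ uu _] := hurwitzS_unitP u.
by rewrite /= ez invrZ // unitfE.
Qed.

Lemma Lambda_ind (P : Lambda -> Prop) :
  (forall u, P (Lambda_class u)) -> forall g, P g.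
Proof. by move=> h g; rewrite -[g]reprK; exact: h. Qed.

Fact Lambda_mulA : associative Lambda_mul.
Proof.
elim/Lambda_ind => u; elim/Lambda_ind => v; elim/Lambda_ind => w.
by rewrite !Lambda_classM mulgA.
Qed.
Fact Lambda_mul1 : left_id Lambda_one Lambda_mul.
Proof. by elim/Lambda_ind => u; rewrite -Lambda_class1 Lambda_classM mul1g. Qed.
Fact Lambda_mulr1 : right_id Lambda_one Lambda_mul.
Proof. by elim/Lambda_ind => u; rewrite -Lambda_class1 Lambda_classM mulg1. Qed.
Fact Lambda_mulV : left_inverse Lambda_one Lambda_inv Lambda_mul.
Proof. by elim/Lambda_ind => u; rewrite Lambda_classV Lambda_classM mulVg. Qed.
Fact Lambda_mulrV : right_inverse Lambda_one Lambda_inv Lambda_mul.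
Proof. by elim/Lambda_ind => u; rewrite Lambda_classV Lambda_classM mulgV. Qed.

HB.instance Definition _ := isGroup.Build Lambda
  Lambda_mulA Lambda_mul1 Lambda_mulr1 Lambda_mulV Lambda_mulrV.

End SArithmetic.

Section Lattice.
Variable p : prime_nat.

(** The Z_p-span of a finite family that spans V over Q_p. *)
Definition is_lattice (V : lmodType (Qp p)) (L : set V) : Prop :=
  exists n (e : 'I_n -> V),
    (forall x, exists c : 'I_n -> Qp p, x = \sum_i c i *: e i) /\
    L = [set x | exists a : 'I_n -> padic_int p, x = \sum_i tofrac (a i) *: e i].

Definition is_order (O : set (quat (Qp p))) : Prop :=
  [/\ is_lattice O, O 1 & forall x y, O x -> O y -> O (x * y)].

Definition is_maximal_order (O : set (quat (Qp p))) : Prop :=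
  is_order O /\ forall O', is_order O' -> O `<=` O' -> O' = O.

(** The inclusion of D in its base change to Q_p. *)
Definition quat_Qp (x : D) : quat (Qp p) :=
  Quat (ratr (q_re x)) (ratr (q_i x)) (ratr (q_j x)) (ratr (q_k x)).

End Lattice.

Section Generators.

(** [O2] stands for the maximal order of the skew field D_2; the square of its
    maximal ideal is 2 O2, so [U2] is 1 + m_2^2. *)
Variable O2 : set (quat (Qp prime2)).

Definition U2 : set (quat (Qp prime2)) := [set 1 + 2 * y | y in O2].

Definition A_set (p : prime_nat) : set D :=
  [set x | [/\ hurwitz x, Nrd x = p%:R &
    exists z u, [/\ z != 0, U2 u & quat_Qp prime2 x = z *: u]]].

(** Only used for odd p, so that the second case is p = 3 mod 4. *)
Definition A'_set (p : prime_nat) : set D :=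
  if (p %% 4 == 1)%N then A_set p else [set x * D_i | x in A_set p].

Variable S : {fset place}.

Definition PA'_set (p : prime_nat) : set (Lambda S) :=
  [set g | exists2 u, A'_set p (val u) & g = Lambda_class u].

Definition is_subgroup (G : groupType) (H : set G) : Prop :=
  [/\ H 1%g, forall x y, H x -> H y -> H (x * y)%g & forall x, H x -> H x^-1%g].

Definition generated_subgroup (G : groupType) (A : set G) : set G :=
  [set g | forall H, is_subgroup H -> A `<=` H -> H g].

Definition Gamma' : set (Lambda S) :=
  generated_subgroup (\bigcup_(p : S0_prime S) PA'_set (val p)).

End Generators.

Section Homothety.
Variable K : fieldType.
Local Notation V := 'cV[K]_2.

Definition dilate (c : K) (L : set V) : set V := [set c *: v | v in L].

Definition homothety_class (L : set V) : set (set V) :=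
  [set dilate c L | c in [set c : K | c != 0]].

Definition GL2_act (M : 'M[K]_2) (v : set (set V)) : set (set V) :=
  [set [set M *m x | x in L] | L in v].

Lemma GL2_act_scale (c : K) (M : 'M[K]_2) (L0 : set V) : c != 0 ->
  GL2_act (c *: M) (homothety_class L0) = GL2_act M (homothety_class L0).
Proof.
move=> c0; rewrite /GL2_act; apply/seteqP; split=> _ [_ [d d0 <-] <-].
  exists (dilate (c * d) L0); first by exists (c * d) => //; apply: mulf_neq0.
  apply/seteqP; split=> _ [_ [x Lx <-] <-].
    exists (d *: x); first by exists x.
    by rewrite -scalemxAl !scalemxAr scalerA.
  exists ((c * d) *: x); first by exists x.
  by rewrite -scalemxAl !scalemxAr scalerA.
exists (dilate (c^-1 * d) L0).
  by exists (c^-1 * d) => //; apply: mulf_neq0 => //; apply: invr_neq0.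
apply/seteqP; split=> _ [_ [x Lx <-] <-].
  exists (d *: x); first by exists x.
  by rewrite -scalemxAl !scalemxAr scalerA mulVKf.
exists ((c^-1 * d) *: x); first by exists x.
by rewrite -scalemxAl !scalemxAr scalerA mulVKf.
Qed.

End Homothety.

Section Tree.
Variable p : prime_nat.
Local Notation V := 'cV[Qp p]_2.

Definition tree_vertex (v : set (set V)) : Prop :=
  exists2 L, is_lattice L & v = homothety_class L.

Definition tree_adjacent (v w : set (set V)) : Prop :=
  [/\ tree_vertex v, tree_vertex w &
    exists L M, [/\ v L, w M, dilate p%:R L `<` M & M `<` L]].

(** A cell is identified with its set of vertices. *)
Definition tree_cell (c : set (set (set V))) : Prop :=
  (exists2 v, tree_vertex v & c = [set v]) \/
  (exists v w, tree_adjacent v w /\ c = [set v; w]).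

Lemma quat_QpZ (a : rat) (x : D) : quat_Qp p (a *: x) = ratr a *: quat_Qp p x.
Proof. by case: x => *; congr Quat; apply: ratr_QpM. Qed.

End Tree.

Section CubeComplex.
Variable S : {fset place}.

Definition cube_vertex
    (v : forall p : S0_prime S, set (set 'cV[Qp (val p)]_2)) : Prop :=
  forall p, tree_vertex (v p).

(** A cell of the product is a product of cells. *)
Definition cube_cell
    (c : forall p : S0_prime S, set (set (set 'cV[Qp (val p)]_2))) : Prop :=
  forall p, tree_cell (c p).

Variable phi : forall p : S0_prime S, {lrmorphism quat (Qp (val p)) -> 'M[Qp (val p)]_2}.

Definition Lambda_act (g : Lambda S)
    (v : forall p : S0_prime S, set (set 'cV[Qp (val p)]_2)) :
    forall p : S0_prime S, set (set 'cV[Qp (val p)]_2) :=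
  fun p => GL2_act (phi p (quat_Qp (val p) (val (repr g)))) (v p).

(** The action does not depend on the chosen representatives. *)
Lemma Lambda_act_class (u : hurwitzS_unit S) v : cube_vertex v ->
  Lambda_act (Lambda_class u) v =
  fun p => GL2_act (phi p (quat_Qp (val p) (val u))) (v p).
Proof.
move=> hv; apply/functional_extensionality_dep => p; rewrite /Lambda_act.
have [z [z0 _ _] ->] := repr_Lambda_class u.
have [L _ ->] := hv p.
by rewrite quat_QpZ linearZ GL2_act_scale // ratr_Qp_eq0.
Qed.

Definition Lambda_act_cell (g : Lambda S)
    (c : forall p : S0_prime S, set (set (set 'cV[Qp (val p)]_2))) :
    forall p : S0_prime S, set (set (set 'cV[Qp (val p)]_2)) :=
  fun p => GL2_act (phi p (quat_Qp (val p) (val (repr g)))) @` c p.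

End CubeComplex.

(* Main.v *)
(** The Hurwitz order is right Euclidean.  For odd p, the tree of M_2(Q_p) has a
    base vertex v0 stabilised by (quaternions over Z_p)^x; a lattice L between
    p^N L0 and L0 is recovered from the right ideal of Hurwitz quaternions x with
    x L0 contained in L, which is principal, so every vertex is x v0 with Nrd x a
    power of p.  Such an x is, up to a power of p and a unit, a product of
    Hurwitz quaternions of norm p, each of which can be moved into A'_p by a
    unit since the units of norm 1 cover all odd classes modulo 2.  This gives
    transitivity, one prime at a time.

    The coordinates of the elements of A'_p have the parity pattern of 1 or of
    1 + j + k, and these Lipschitz quaternions are closed under product and
    conjugation.  If such a quaternion fixes v0, its primitive multiple has norm
    prime to all p in S and hence norm 1, so it is +1 or -1 by parity.  If a
    power of it is central, then 4a^2/Nrd x - 2, the trace of x^2/Nrd x, is an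
    integer, where a is the odd real part; since Nrd x is odd this forces
    Nrd x = a^2, so there is no torsion.  Finally, the square of an element fixing
    a cell fixes a vertex. *)
Require Import Defs.
From HB Require Import structures.
From mathcomp Require Import all_boot all_order all_algebra ring lra zify.
From mathcomp Require Import generic_quotient finmap.
From mathcomp Require Import boolp classical_sets functions.

Set Implicit Arguments.
Unset Strict Implicit.
Unset Printing Implicit Defensive.

Import Order.TTheory GRing.Theory Num.Theory.
Local Open Scope classical_set_scope.
Local Open Scope ring_scope.

(** * The fields Q_p *)

(** Two objects come without coordinates: the maximal order at 2 and the splittings [phi p]. The
    order is recovered from the norm: over Q_2 the elements of integral norm are closed under
    addition, because four integer squares summing to a multiple of 4 have equal parities, and so
    they form the largest order. Being trivial modulo U^2 then becomes a congruence modulo 2 on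
    Hurwitz coordinates. A splitting is only an abstract isomorphism, so matrix entries carry no
    integrality. The base lattice is built instead from an integral quaternion n of norm 0 and trace
    1: n is idempotent, it fixes a vector e1, and the lattice is the orbit of e1 under the
    quaternions over Z_p. The identity n z n = tr(z n) n replaces computations with matrices. The
    primes decouple because a generator taken at p has norm p, which is a unit at any other prime q
    of S_0, and so it fixes the base vertex at q. *)

Section PadicDivision.
Variable p : prime_nat.
Local Notation q := (p%:Z).
Implicit Types x y : padic_int p.

Lemma prime_pow_neq0 n : q ^+ n != 0.
Proof. by rewrite expf_neq0 // -lt0n p_gt0. Qed.

Lemma padic_comp_pow n m :
  padic_comp (p%:R ^+ n : padic_int p) m = (q ^+ n %% q ^+ m)%Z.
Proof. by rewrite -natrX padic_nat_comp -natz natrX natz. Qed.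

Lemma padic_int_comp (m : int) n :
  padic_comp (m%:~R : padic_int p) n = (m %% q ^+ n)%Z.
Proof.
case: m => m; first exact: padic_nat_comp.
rewrite NegzE mulrNz [LHS]padic_ofE padic_nat_comp.
exact: modzNm.
Qed.

Lemma padic_dvd_pow n x : padic_comp x n = 0 -> exists y, x = p%:R ^+ n * y.
Proof.
(* Dividing by p^n costs n digits, so component [m] of the quotient is read off component [m + n] of
   [x]. *)
move=> x0; pose f m := (padic_comp x (m + n) %/ q ^+ n)%Z.
have fE m : q ^+ n * f m = padic_comp x (m + n).
  rewrite mulrC divzK //; apply/dvdz_mod0P.
  by rewrite padic_le ?leq_addl.
have cf : compatible p f.
  move=> m; apply/eqP; rewrite eqz_mod_dvd.
  rewrite -(@dvdz_mul2l (q ^+ n)) ?prime_pow_neq0 // mulrBr !fE -exprD -eqz_mod_dvd.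
  by rewrite addSn [(n + m)%N]addnC padic_comp_compat.
exists (padic_of cf); apply: padic_compP => N.
rewrite [RHS]padic_ofE padic_comp_pow padic_ofE modzMm fE.
by rewrite padic_le ?leq_addr.
Qed.

(** Bezout inverts component n modulo [q ^+ n]; inverses modulo [q ^+ n] are unique, which makes the
    chosen ones compatible. *)
Lemma padic_inverse x : padic_comp x 1 != 0 -> exists y, y * x = 1.
Proof.
move=> x0.
have cop n : coprimez (padic_comp x n) (q ^+ n).
  case: n => [|n]; first by rewrite expr0 /coprimez gcdz1.
  rewrite coprimezXr // coprimez_sym coprimezE prime_coprime ?p_prime //.
  apply/negP => h; case/eqP: x0; have := @padic_le p x 1 n.+1 isT.
  by rewrite expr1 => <-; apply/dvdz_mod0P.
pose f n := (egcdz (padic_comp x n) (q ^+ n)).1.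
have fE n : (q ^+ n %| f n * padic_comp x n - 1)%Z.
  rewrite /f; case: egcdzP => u v e _ /=.
  move/eqP: (cop n) => c; rewrite c in e.
  by rewrite -e opprD addrA subrr add0r rpredN; exact: dvdz_mull.
have cf : compatible p f.
  move=> n; apply/eqP; rewrite eqz_mod_dvd.
  have c : coprimez (q ^+ n) (padic_comp x n) by rewrite coprimez_sym.
  rewrite -(Gauss_dvdzl (f n.+1 - f n) c).
  have d : (q ^+ n %| padic_comp x n.+1 - padic_comp x n)%Z.
    by rewrite -eqz_mod_dvd padic_comp_compat.
  have e : (q ^+ n %| f n.+1 * padic_comp x n.+1 - 1)%Z.
    by apply: dvdz_trans (fE _); rewrite exprS dvdz_mull.
  have -> : (f n.+1 - f n) * padic_comp x n = (f n.+1 * padic_comp x n.+1 - 1)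
     - f n.+1 * (padic_comp x n.+1 - padic_comp x n) - (f n * padic_comp x n - 1).
    by ring.
  by apply: rpredB; [apply: rpredB; [|exact: dvdz_mull]|].
exists (padic_of cf); apply: padic_compP => n.
rewrite [LHS]padic_ofE [RHS]padic_ofE padic_ofE modzMml.
by apply/eqP; rewrite eqz_mod_dvd.
Qed.

Lemma padic_factor x : x != 0 -> exists n u, x = p%:R ^+ n * u /\ exists v, v * u = 1.
Proof.
move=> /padic_neq0 nx.
have nx' : exists n, padic_comp x n != 0.
  by case: nx => n h; exists n; apply: contra h => /eqP ->; rewrite dvdz0.
(* The least index with a nonzero component is one more than the valuation; component 0 always
   vanishes, being taken modulo 1. *)
case: (ex_minnP nx') => -[|n] xn mn.
  by move: xn; rewrite -padic_mod expr0 modz1.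
have /padic_dvd_pow[u xu] : padic_comp x n = 0.
  by apply/eqP/negPn/negP => /mn; rewrite ltnn.
exists n, u; split => //; apply: padic_inverse; apply: contra xn => /eqP.
case/padic_dvd_pow => v uv; rewrite xu uv mulrA -exprD addn1.
rewrite [padic_comp _ _]padic_ofE padic_comp_pow modzz mul0r mod0z //.
Qed.

Lemma padic_approx x N : exists (m : int) y, x = m%:~R + p%:R ^+ N * y.
Proof.
pose m := padic_comp x N.
have /padic_dvd_pow[y xy] : padic_comp (x - m%:~R) N = 0.
  rewrite [LHS]padic_ofE [padic_comp (- _) _]padic_ofE padic_int_comp.
  by rewrite modzDmr -modzDmr -modzNm modz_mod modzNm modzDmr subrr mod0z.
by exists m, y; rewrite -xy addrC subrK.
Qed.

Lemma padic_dvdz (m : int) y : m%:~R = p%:R * y -> (p%:Z %| m)%Z.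
Proof.
move=> /(congr1 (fun z => padic_comp z 1)).
rewrite padic_int_comp [RHS]padic_ofE -[p%:R]expr1 padic_comp_pow modzz mul0r mod0z.
by move/dvdz_mod0P.
Qed.

Lemma Qp_frac (x : Qp p) :
  exists a b : padic_int p, b != 0 /\ x = tofrac a / tofrac b.
Proof.
elim/quotW: x => r; exists (frac r).1, (frac r).2.
have r0 := denom_ratioP r; split=> //.
apply: (canRL (mulfK _)); first by rewrite tofrac_eq0.
unlock tofrac; rewrite -[LHS]FracField.pi_mul; apply/eqmodP.
rewrite /= FracField.equivfE /FracField.mulf !numden_Ratio ?mulf_neq0 ?oner_neq0 //.
by rewrite !mulr1 mulrC.
Qed.

End PadicDivision.

(** K and Z stand for Q_p and Z_p.  They are kept abstract because unification and
    [field] unfold the concrete fraction field and do not terminate in practice. *)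
Record local_field (p : nat) (K : fieldType) (Z : {pred K}) : Prop := LocalField {
  local_natr_eq0 : forall n : nat, (n%:R == 0 :> K) = (n == 0)%N;
  local_dichotomy : forall x : K, x != 0 ->
    x^-1 \in Z \/ exists2 y, y \in Z & x = p%:R * y;
  local_clear : forall x : K, exists n, p%:R ^+ n * x \in Z;
  local_approx : forall (x : K) N, x \in Z ->
    exists (m : int) y, y \in Z /\ x = m%:~R + p%:R ^+ N * y;
  local_dvdz : forall (m : int) y, y \in Z -> m%:~R = p%:R * y -> (p%:Z %| m)%Z }.

(** * Fraction fields of discrete valuation rings *)

Section FractionField.
Variables (p : nat) (R : idomainType) (K : fieldType) (tau : {rmorphism R -> K}).
Hypothesis tau_frac : forall x, exists a b, b != 0 /\ x = tau a / tau b.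
Hypothesis tau_eq0 : forall a, (tau a == 0) = (a == 0).
Hypothesis factor : forall a : R, a != 0 ->
  exists n u, a = p%:R ^+ n * u /\ exists v, v * u = 1.
Hypothesis approx : forall (a : R) N, exists (m : int) y, a = m%:~R + p%:R ^+ N * y.
Hypothesis p_dvd : forall (m : int) (y : R), m%:~R = p%:R * y -> (p%:Z %| m)%Z.
Hypothesis natr_eq0 : forall n : nat, (n%:R == 0 :> K) = (n == 0)%N.
Hypothesis p_neq0 : p != 0%N.

Definition rmorph_image : {pred K} := fun x => `[< exists a : R, x = tau a >].

Lemma rmorph_imageP x : reflect (exists a, x = tau a) (x \in rmorph_image).
Proof. exact: asboolP. Qed.

Lemma rmorph_image_subring : subring_closed rmorph_image.
Proof.
split=> [|x y /rmorph_imageP[a ->] /rmorph_imageP[b ->]|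
          x y /rmorph_imageP[a ->] /rmorph_imageP[b ->]].
- by apply/rmorph_imageP; exists 1; rewrite rmorph1.
- by apply/rmorph_imageP; exists (a - b); rewrite rmorphB.
- by apply/rmorph_imageP; exists (a * b); rewrite rmorphM.
Qed.
HB.instance Definition _ := GRing.isSubringClosed.Build K rmorph_image rmorph_image_subring.

Lemma rmorph_image_tau a : tau a \in rmorph_image.
Proof. by apply/rmorph_imageP; exists a. Qed.

Let p0 : p%:R != 0 :> K. Proof. by rewrite natr_eq0. Qed.

Let tau_factor (a : R) : a != 0 ->
  exists n (u : K), [/\ tau a = p%:R ^+ n * u, u \in rmorph_image,
    u^-1 \in rmorph_image & u != 0].
Proof.
move=> /factor[n [u [-> [v vu]]]].
have vuF : tau v * tau u = 1 by rewrite -rmorphM vu rmorph1.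
have u0 : tau u != 0.
  by apply/eqP => e; move/eqP: vuF; rewrite e mulr0 eq_sym oner_eq0.
exists n, (tau u); rewrite rmorphM rmorphXn rmorph_nat rmorph_image_tau; split=> //.
suff -> : (tau u)^-1 = tau v by exact: rmorph_image_tau.
by rewrite -[LHS]mul1r -vuF mulfK.
Qed.

Let frac_factor x : x != 0 -> exists n m (u : K),
  [/\ x = p%:R ^+ n / p%:R ^+ m * u, u \in rmorph_image,
      u^-1 \in rmorph_image & u != 0].
Proof.
have [a [b [b0 ->]]] := tau_frac x; have [->|a0 _] := eqVneq a 0.
  by rewrite rmorph0 mul0r eqxx.
have [n [u [-> u1 u2 u0]]] := tau_factor a0.
have [m [v [-> v1 v2 v0]]] := tau_factor b0.
exists n, m, (u / v); split.
- by field; rewrite v0 expf_neq0.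
- exact: rpredM.
- by rewrite invfM invrK rpredM.
- by rewrite mulf_neq0 ?invr_neq0.
Qed.

Lemma fraction_local_field : local_field p rmorph_image.
Proof.
split=> //.
- move=> x /frac_factor[n [m [u [-> u1 u2 u0]]]]; case: (leqP n m) => [nm|mn].
    left; suff -> : (p%:R ^+ n / p%:R ^+ m * u)^-1 = p%:R ^+ (m - n) * u^-1.
      by rewrite rpredM ?rpredX ?rpred_nat.
    by rewrite -{1}(subnK nm) exprD; field; rewrite u0 !expf_neq0.
  right; exists (p%:R ^+ (n - m).-1 * u); first by rewrite rpredM ?rpredX ?rpred_nat.
  have -> : n = ((n - m).-1 + m).+1 by lia.
  by rewrite subSn ?leq_addl // addnK /= exprS exprD; field; rewrite expf_neq0.
- move=> x; have [->|/frac_factor[n [m [u [-> u1 _ _]]]]] := eqVneq x 0.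
    by exists 0%N; rewrite mulr0 rpred0.
  exists m; suff -> : p%:R ^+ m * (p%:R ^+ n / p%:R ^+ m * u) = p%:R ^+ n * u.
    by rewrite rpredM ?rpredX ?rpred_nat.
  by field; rewrite expf_neq0.
- move=> x N /rmorph_imageP[a ->]; have [m [y ->]] := approx a N.
  exists m, (tau y); rewrite rmorph_image_tau.
  by rewrite rmorphD rmorphM rmorph_int rmorphXn rmorph_nat.
- move=> m y /rmorph_imageP[a ->] e; apply: (p_dvd (y := a)).
  by apply/eqP; rewrite -subr_eq0 -tau_eq0 rmorphB rmorphM rmorph_int rmorph_nat e subrr.
Qed.

End FractionField.

Definition Zint p : {pred Qp p} := rmorph_image (@tofrac (padic_int p)).
HB.instance Definition _ p := GRing.SubringClosed.on (@Zint p).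

Lemma ZintP p (x : Qp p) : reflect (exists a, x = tofrac a) (x \in @Zint p).
Proof. exact: rmorph_imageP. Qed.

Lemma Qp_local_field (p : prime_nat) : local_field p (@Zint p).
Proof.
apply: fraction_local_field.
- exact: Qp_frac.
- exact: tofrac_eq0.
- exact: padic_factor.
- exact: padic_approx.
- exact: padic_dvdz.
- exact: Qp_natr_eq0.
- by rewrite -lt0n p_gt0.
Qed.

(** * Rational numbers and rational quaternions in a completion *)

Section RationalEmbedding.
Variables (p : nat) (K : fieldType) (Z : subringClosed K).
Hypothesis KZ : local_field p Z.

Lemma local_intr_eq0 (n : int) : (n%:~R == 0 :> K) = (n == 0).
Proof.
by case: n => n; rewrite ?NegzE ?mulrNz ?oppr_eq0 -pmulrn (local_natr_eq0 KZ).
Qed.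

Lemma local_ratr (a b : int) : b != 0 -> ratr (a%:~R / b%:~R) = a%:~R / b%:~R :> K.
Proof.
move=> b0; set x := a%:~R / b%:~R; rewrite /ratr.
apply/eqP; rewrite eqr_div ?local_intr_eq0 ?denq_neq0 // -!intrM.
suff -> : numq x * b = a * denq x by [].
apply: (@intr_inj rat); rewrite !intrM.
by apply/eqP; rewrite -eqr_div ?intr_eq0 ?denq_neq0 // divq_num_den.
Qed.

Lemma local_ratr_frac (x : rat) : exists a b : int, b != 0 /\ x = a%:~R / b%:~R.
Proof. by exists (numq x), (denq x); rewrite divq_num_den denq_neq0. Qed.

Lemma local_ratrM (x y : rat) : ratr (x * y) = ratr x * ratr y :> K.
Proof.
have [a [b [b0 ->]]] := local_ratr_frac x; have [c [d [d0 ->]]] := local_ratr_frac y.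
by rewrite mulf_div -!intrM !local_ratr ?mulf_neq0 // mulf_div !intrM.
Qed.

Lemma local_ratrD (x y : rat) : ratr (x + y) = ratr x + ratr y :> K.
Proof.
have [a [b [b0 ->]]] := local_ratr_frac x; have [c [d [d0 ->]]] := local_ratr_frac y.
rewrite addf_div ?intr_eq0 // -!intrM -intrD !local_ratr ?mulf_neq0 //.
by rewrite addf_div ?local_intr_eq0 // intrD !intrM.
Qed.

Lemma local_ratr_int (m : int) : ratr m%:~R = m%:~R :> K.
Proof. by have := @local_ratr m 1 isT; rewrite !divr1. Qed.

Lemma local_ratrN (x : rat) : ratr (- x) = - ratr x :> K.
Proof. by rewrite -mulN1r local_ratrM (local_ratr_int (-1)) mulN1r. Qed.

Lemma local_one_neq_pmul y : prime p -> y \in Z -> 1 <> p%:R * y.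
Proof.
move=> pp yZ e; have /(_ 1 y yZ e) := local_dvdz KZ.
by rewrite dvdz1 /= => /eqP e1; rewrite e1 in pp.
Qed.

Lemma local_coprime_inv (m : int) : ~~ (p%:Z %| m)%Z -> (m%:~R : K)^-1 \in Z.
Proof.
move=> pm; have m0 : m%:~R != 0 :> K.
  by rewrite local_intr_eq0; apply: contra pm => /eqP ->; rewrite dvdz0.
case: (local_dichotomy KZ m0) => // -[y yZ e].
by case/negP: pm; exact: local_dvdz KZ _ _ yZ e.
Qed.

(** Otherwise x = 1/(p y) with y integral, and the exponent N + 1 already gives 1 = p z y^(N+1) with
    z integral. This plays the part of integral closedness for elements of an order. *)
Lemma local_bounded_powers N (x : K) : prime p ->
  (forall n, p%:R ^+ N * x ^+ n \in Z) -> x \in Z.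
Proof.
move=> pp h; have [->|x0] := eqVneq x 0; first exact: rpred0.
have xV0 : x^-1 != 0 by rewrite invr_eq0.
case: (local_dichotomy KZ xV0) => [|[y yZ e]]; first by rewrite invrK.
have p0 : p%:R != 0 :> K by rewrite (local_natr_eq0 KZ) -lt0n prime_gt0.
have := h N.+1; set z := _ * _ => zZ.
case: (@local_one_neq_pmul (z * y ^+ N.+1) pp); first by rewrite rpredM ?rpredX.
have xE : x = (p%:R * y)^-1 by rewrite -e invrK.
have y0 : y != 0 by apply: contraNneq xV0 => y0; rewrite e y0 mulr0.
rewrite /z xE exprVn !exprMn exprS.
by field; rewrite !expf_neq0 // p0.
Qed.

(** Over Q_p this is convertible to [quat_Qp], which is how results over the abstract field are
    transferred. *)
Definition quat_emb (x : D) : quat K :=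
  Quat (ratr (q_re x)) (ratr (q_i x)) (ratr (q_j x)) (ratr (q_k x)).

Lemma quat_embD x y : quat_emb (x + y) = quat_emb x + quat_emb y.
Proof. by case: x y => ? ? ? ? [? ? ? ?]; congr Quat; apply: local_ratrD. Qed.

Lemma quat_embZ a x : quat_emb (a *: x) = ratr a *: quat_emb x.
Proof. by case: x => ? ? ? ?; congr Quat; apply: local_ratrM. Qed.

Lemma quat_embM x y : quat_emb (x * y) = quat_emb x * quat_emb y.
Proof.
case: x y => ? ? ? ? [? ? ? ?]; rewrite /quat_emb !quatME /=.
by rewrite !(local_ratrD, local_ratrM, local_ratrN).
Qed.

Lemma quat_emb1 : quat_emb 1 = 1.
Proof. by congr Quat; rewrite /= (local_ratr_int 0, local_ratr_int 1). Qed.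

Lemma quat_emb_Nrd x : Nrd (quat_emb x) = ratr (Nrd x).
Proof. by rewrite /Nrd /= !local_ratrD !expr2 !local_ratrM. Qed.

Lemma quat_emb_unit x : x \is a GRing.unit -> quat_emb x \is a GRing.unit.
Proof.
move=> ux; apply/unitrP; exists (quat_emb x^-1).
by rewrite -!quat_embM mulVr // mulrV // quat_emb1.
Qed.

Lemma quat_embV x : x \is a GRing.unit -> quat_emb x^-1 = (quat_emb x)^-1.
Proof.
move=> ux; apply: (mulIr (quat_emb_unit ux)).
by rewrite -quat_embM !mulVr ?quat_emb1 // quat_emb_unit.
Qed.

End RationalEmbedding.

Arguments quat_emb : clear implicits.

Section Lattices.
Variables (K : fieldType) (Z : subringClosed K).

(** The coefficients are elements of K lying in [Z], not images of p-adic integers, so that no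
    second ring is involved over an abstract K. *)
Definition Zlattice (V : lmodType K) (L : set V) : Prop :=
  exists n (e : 'I_n -> V),
    (forall x, exists c : 'I_n -> K, x = \sum_i c i *: e i) /\
    L = [set x | exists a : 'I_n -> K, (forall i, a i \in Z) /\ x = \sum_i a i *: e i].

Variables (V : lmodType K) (L : set V).
Hypothesis latL : Zlattice L.

Lemma Zlattice0 : L 0.
Proof.
have [n [e [_ ->]]] := latL; exists (fun=> 0); split=> [i|]; first exact: rpred0.
by rewrite big1 // => i _; rewrite scale0r.
Qed.

Lemma ZlatticeD x y : L x -> L y -> L (x + y).
Proof.
have [n [e [_ ->]]] := latL => -[a [aZ ->]] [b [bZ ->]].
exists (fun i => a i + b i); split=> [i|]; first exact: rpredD.
by rewrite -big_split; apply: eq_bigr => i _; rewrite scalerDl.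
Qed.

Lemma ZlatticeZ c x : c \in Z -> L x -> L (c *: x).
Proof.
have [n [e [_ ->]]] := latL => cZ [a [aZ ->]].
exists (fun i => c * a i); split=> [i|]; first exact: rpredM.
by rewrite scaler_sumr; apply: eq_bigr => i _; rewrite scalerA.
Qed.

End Lattices.

Lemma is_lattice_Zlattice (p : prime_nat) (V : lmodType (Qp p)) (L : set V) :
  is_lattice L <-> Zlattice (@Zint p) L.
Proof.
have spanE n (e : 'I_n -> V) :
    [set x | exists a : 'I_n -> padic_int p, x = \sum_i tofrac (a i) *: e i] =
    [set x | exists a : 'I_n -> Qp p, (forall i, a i \in @Zint p) /\ x = \sum_i a i *: e i].
  apply/seteqP; split=> x /= [a].
    by move=> ->; exists (fun i => tofrac (a i)); split=> // i; apply/ZintP; exists (a i).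
  case=> /(_ _)/ZintP/cid aE ->; exists (fun i => projT1 (aE i)).
  by apply: eq_bigr => i _; rewrite -(projT2 (aE i)).
by split=> -[n [e [sp ->]]]; exists n, e; rewrite ?spanE -?spanE.
Qed.

Ltac closed :=
  rewrite ?(rpredB, rpredD, rpredN, rpredM, rpredX, rpred_int, rpred_nat, rpred1, rpred0).

Section CommonDenominators.
Variables (p : nat) (K : fieldType) (Z : subringClosed K).
Hypothesis KZ : local_field p Z.

Lemma local_clear_le m n (x : K) :
  (m <= n)%N -> p%:R ^+ m * x \in Z -> p%:R ^+ n * x \in Z.
Proof.
by move=> /subnK <- h; rewrite exprD -mulrA rpredM ?rpredX ?rpred_nat.
Qed.

Lemma local_clear_fin (I : finType) (f : I -> K) :
  exists n, forall i, p%:R ^+ n * f i \in Z.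
Proof.
pose h i := projT1 (cid (local_clear KZ (f i))).
exists (\max_i h i)%N => i; apply: (local_clear_le (m := h i)).
  exact: leq_bigmax.
exact: projT2 (cid (local_clear KZ (f i))).
Qed.

Definition integral_quat (x : quat K) : bool :=
  [&& q_re x \in Z, q_i x \in Z, q_j x \in Z & q_k x \in Z].

Fact integral_quat_subring : subring_closed [pred x | integral_quat x].
Proof.
split=> [|[a b c d] [e f g h] /and4P[/= ? ? ? ?] /and4P[/= ? ? ? ?]
  |[a b c d] [e f g h] /and4P[/= ? ? ? ?] /and4P[/= ? ? ? ?]]; apply/and4P => /=.
- by rewrite rpred0 rpred1.
- by split; apply: rpredB.
- by split; rewrite /= ?(rpredB, rpredD, rpredM).
Qed.

Lemma quat_clear (x : quat K) : exists n, integral_quat (p%:R ^+ n *: x).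
Proof.
have [n hn] := local_clear_fin (fun i : 'I_4 => nth 0 [:: q_re x; q_i x; q_j x; q_k x] i).
exists n; case: x hn => a b c d hn; apply/and4P; split.
- exact: (hn (@Ordinal 4 0 isT)).
- exact: (hn (@Ordinal 4 1 isT)).
- exact: (hn (@Ordinal 4 2 isT)).
- exact: (hn (@Ordinal 4 3 isT)).
Qed.

Lemma integral_quatZ a x : a \in Z -> integral_quat x -> integral_quat (a *: x).
Proof. by case: x => ? ? ? ? aZ /and4P[? ? ? ?]; apply/and4P; split; apply: rpredM. Qed.

End CommonDenominators.

HB.instance Definition _ (K : fieldType) (Z : subringClosed K) :=
  GRing.isSubringClosed.Build (quat K) [pred x | integral_quat Z x]
    (integral_quat_subring Z).

(** * Sums of four squares modulo 4 and 8 *)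

Lemma int_parity (m : int) : (exists k, m = 2 * k) \/ (exists k, m = 2 * k + 1).
Proof.
have := divz_eq m 2; have := modz_ge0 m (isT : (2 : int) != 0).
have := ltz_pmod m (isT : 0 < (2 : int)) => h1 h2 h3.
have : (m %% 2)%Z = 0 \/ (m %% 2)%Z = 1 by lia.
by case=> e; [left | right]; exists (m %/ 2)%Z; lia.
Qed.

Lemma sum4_squares_mod4 (a b c d w : int) :
  a ^+ 2 + b ^+ 2 + c ^+ 2 + d ^+ 2 = 4 * w ->
  (exists a' b' c' d', [/\ a = 2 * a', b = 2 * b', c = 2 * c' & d = 2 * d']) \/
  (exists a' b' c' d', [/\ a = 2 * a' + 1, b = 2 * b' + 1, c = 2 * c' + 1
     & d = 2 * d' + 1]).
Proof.
case: (int_parity a) => -[a' ->]; case: (int_parity b) => -[b' ->];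
case: (int_parity c) => -[c' ->]; case: (int_parity d) => -[d' ->] e;
  try (exfalso; lia).
- by left; exists a', b', c', d'.
- by right; exists a', b', c', d'.
Qed.

Lemma odd_square (k : int) : exists t, (2 * k + 1) ^+ 2 = 8 * t + 1.
Proof.
case: (int_parity k) => -[l ->]; [exists (2 * l ^+ 2 + l) | exists (2 * l ^+ 2 + 3 * l + 1)];
  ring.
Qed.

Lemma sum4_odd_squares_mod8 (a b c d w : int) :
  (2 * a + 1) ^+ 2 + (2 * b + 1) ^+ 2 + (2 * c + 1) ^+ 2 + (2 * d + 1) ^+ 2 <> 8 * w.
Proof.
have [[s ->] [t ->]] := (odd_square a, odd_square b).
have [[u ->] [v ->]] := (odd_square c, odd_square d).
by lia.
Qed.

Definition hurwitz_coords (K : fieldType) (a b c d : K) : quat K :=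
  Quat (a + d / 2) (b + d / 2) (c + d / 2) (d / 2).

Lemma Nrd_hurwitz_coords (K : fieldType) (a b c d : K) : 2 != 0 :> K ->
  Nrd (hurwitz_coords a b c d) = a ^+ 2 + b ^+ 2 + c ^+ 2 + (a + b + c) * d + d ^+ 2.
Proof. by move=> two_neq0; rewrite /Nrd /=; field. Qed.

(** * The maximal order at 2 *)

Section TwoAdic.
Variables (K : fieldType) (Z : subringClosed K).
Hypothesis KZ : local_field 2 Z.

Let two_neq0 : 2 != 0 :> K. Proof. by rewrite (local_natr_eq0 KZ). Qed.

Lemma local_dvd_pow2 (m : int) n y : y \in Z -> m%:~R = 2 ^+ n * y ->
  exists k, m = 2 ^+ n * k.
Proof.
elim: n m => [|n IH] m yZ; first by exists m; rewrite mul1r.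
rewrite exprS -mulrA => e.
have /dvdzP[k mk] : (2%:Z %| m)%Z.
  by apply: local_dvdz KZ _ _ _ e; rewrite rpredM ?rpredX ?rpred_nat.
have [] := IH k yZ.
  by apply: (mulfI two_neq0); rewrite -e mk intrM mulrC.
by move=> l kl; exists l; rewrite mk kl exprS; ring.
Qed.

(** Let 2^n be the least power clearing the denominators of x. If n > 0, the squares of the
    coordinates of 2^n x sum to 4^n Nrd x, so these coordinates have equal parities. All even
    contradicts minimality; all odd makes the sum 4 modulo 8, whence n = 1 and x has half-odd
    coordinates. *)
Lemma integral_Nrd_coords x : Nrd x \in Z ->
  exists a b c d, [/\ a \in Z, b \in Z, c \in Z & d \in Z] /\ x = hurwitz_coords a b c d.
Proof.
move=> xZ; have ex := quat_clear KZ x.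
case: (ex_minnP ex) => -[|n] nx nmin.
  case: x xZ nx {ex nmin} => a b c d _; rewrite expr0 scale1r => /and4P[/= aZ bZ cZ dZ].
  exists (a - d), (b - d), (c - d), (2 * d).
  rewrite !rpredB // rpredM ?rpred_nat //; split=> //.
  by congr Quat; field.
have {}nmin : ~ integral_quat Z (2 ^+ n *: x) by move/nmin; rewrite ltnn.
case: x xZ nx nmin {ex} => a b c d xZ /and4P[/= aZ bZ cZ dZ] nmin.
(* Precision 2^3 is enough, as (m + 8 y)^2 = m^2 + 16 (m y + 4 y^2); [w] below collects the four
   corrections. *)
have [a' [ya [yaZ ea]]] := local_approx KZ 3 aZ.
have [b' [yb [ybZ eb]]] := local_approx KZ 3 bZ.
have [c' [yc [ycZ ec]]] := local_approx KZ 3 cZ.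
have [d' [yd [ydZ ed]]] := local_approx KZ 3 dZ.
pose w := a'%:~R * ya + b'%:~R * yb + c'%:~R * yc + d'%:~R * yd
  + 4 * (ya ^+ 2 + yb ^+ 2 + yc ^+ 2 + yd ^+ 2).
have wZ : w \in Z by rewrite /w; closed.
have eS : (a' ^+ 2 + b' ^+ 2 + c' ^+ 2 + d' ^+ 2)%:~R
   = 4 * (4 ^+ n * Nrd (Quat a b c d) - 4 * w).
  have -> : 4 * (4 ^+ n * Nrd (Quat a b c d) - 4 * w)
      = (2 ^+ n.+1 * a) ^+ 2 + (2 ^+ n.+1 * b) ^+ 2 + (2 ^+ n.+1 * c) ^+ 2
        + (2 ^+ n.+1 * d) ^+ 2 - 16 * w.
    rewrite (_ : 4 ^+ n = (2 ^+ n) ^+ 2); last by rewrite -exprM mulnC exprM expr2 -natrM.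
    by rewrite /Nrd /= [2 ^+ n.+1]exprS; ring.
  by rewrite ea eb ec ed /w !intrD !rmorphXn /=; ring.
have [s sE] : exists s, a' ^+ 2 + b' ^+ 2 + c' ^+ 2 + d' ^+ 2 = 2 ^+ 2 * s.
  apply: (local_dvd_pow2 (y := 4 ^+ n * Nrd (Quat a b c d) - 4 * w)).
    by move: (Nrd _) xZ => N NZ; closed.
  by rewrite eS; ring.
have halve (m : int) (y z : K) :
    2 ^+ n.+1 * z = (2 * m)%:~R + 2 ^+ 3 * y -> 2 ^+ n * z = m%:~R + 2 ^+ 2 * y.
  by rewrite exprS intrM => e; apply: (mulfI two_neq0); rewrite mulrA e; ring.
case: (sum4_squares_mod4 sE) => -[a1 [b1 [c1 [d1 [aE bE cE dE]]]]].
  case: nmin; subst a' b' c' d'; apply/and4P => /=.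
  by rewrite (halve _ _ _ ea) (halve _ _ _ eb) (halve _ _ _ ec) (halve _ _ _ ed);
    split; closed.
(* The minimal exponent is [n.+1]: for [n = 0] the quaternion is half-integral, while a larger [n]
   would make the sum of four odd squares a multiple of 8. *)
case: n aZ bZ cZ dZ ea eb ec ed eS nmin halve => [|n] aZ bZ cZ dZ ea eb ec ed eS _ halve.
  have half (m : int) (y z : K) :
      2 ^+ 1 * z = (2 * m + 1)%:~R + 2 ^+ 3 * y -> z = 2^-1 + (m%:~R + 4 * y).
    by rewrite intrD intrM => e; apply: (mulfI two_neq0); rewrite -[2 in LHS]expr1 e; field.
  rewrite aE in ea; rewrite bE in eb; rewrite cE in ec; rewrite dE in ed.
  exists (a1%:~R + 4 * ya - (d1%:~R + 4 * yd)), (b1%:~R + 4 * yb - (d1%:~R + 4 * yd)),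
    (c1%:~R + 4 * yc - (d1%:~R + 4 * yd)), ((2 * d1 + 1)%:~R + 2 ^+ 3 * yd).
  split; first by split; closed.
  rewrite /hurwitz_coords intrD intrM (half _ _ _ ea) (half _ _ _ eb) (half _ _ _ ec).
  by rewrite (half _ _ _ ed); congr Quat; field.
have [s' sE'] : exists s, a' ^+ 2 + b' ^+ 2 + c' ^+ 2 + d' ^+ 2 = 2 ^+ 3 * s.
  apply: (local_dvd_pow2 (y := 2 * 4 ^+ n * Nrd (Quat a b c d) - 2 * w)).
    by move: (Nrd _) xZ => N NZ; closed.
  by rewrite eS [4 ^+ n.+1]exprS; ring.
by rewrite aE bE cE dE in sE'; case: (sum4_odd_squares_mod8 sE').
Qed.

Lemma integral_NrdP x : Nrd x \in Z <->
  exists a b c d, [/\ a \in Z, b \in Z, c \in Z & d \in Z] /\ x = hurwitz_coords a b c d.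
Proof.
split; first exact: integral_Nrd_coords.
case=> a [b [c [d [[aZ bZ cZ dZ] ->]]]].
by rewrite Nrd_hurwitz_coords // !(rpredD, rpredM, rpredX).
Qed.

End TwoAdic.

Lemma NrdZ (R : comNzRingType) (a : R) x : Nrd (a *: x) = a ^+ 2 * Nrd x.
Proof. by case: x => ? ? ? ?; rewrite /Nrd /=; ring. Qed.

Lemma Nrd_natr (R : comNzRingType) m : Nrd (m%:R : quat R) = m%:R ^+ 2.
Proof. by rewrite -[m%:R in LHS]scaler_nat NrdZ Nrd1 mulr1. Qed.

Lemma NrdX (R : comNzRingType) (x : quat R) n : Nrd (x ^+ n) = Nrd x ^+ n.
Proof. by elim: n => [|n IH]; rewrite ?Nrd1 // !exprS NrdM IH. Qed.

Section Orders.
Variables (p : nat) (K : fieldType) (Z : subringClosed K).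
Hypotheses (KZ : local_field p Z) (pp : prime p).

Lemma integral_quat_Nrd (x : quat K) : integral_quat Z x -> Nrd x \in Z.
Proof. by case: x => ? ? ? ? /and4P[/= ? ? ? ?]; rewrite !rpredD ?rpredX. Qed.

(** All powers of [x] stay in the lattice [O], whose elements have denominators dividing a fixed
    p^n; so p^(2n) Nrd(x)^k is integral for every k. *)
Lemma order_integral_Nrd (O : set (quat K)) x : Zlattice Z O -> O 1 ->
  (forall x y, O x -> O y -> O (x * y)) -> O x -> Nrd x \in Z.
Proof.
move=> [m [e [_ OE]]] O1 OM Ox.
pose N i := projT1 (cid (quat_clear KZ (e i))); pose n := (\max_i N i)%N.
have eZ i : integral_quat Z (p%:R ^+ n *: e i).
  have /subnK <- : (N i <= n)%N by exact: leq_bigmax.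
  rewrite exprD -scalerA integral_quatZ ?rpredX ?rpred_nat //.
  exact: projT2 (cid (quat_clear KZ (e i))).
have OZ y : O y -> integral_quat Z (p%:R ^+ n *: y).
  rewrite OE => -[a [aZ ->]]; rewrite scaler_sumr.
  have := @rpred_sum _ [pred x | integral_quat Z x] 'I_m (index_enum _) predT.
  apply => i _; rewrite inE scalerA mulrC -scalerA; exact: integral_quatZ.
have OX k : O (x ^+ k) by elim: k => [|k IH]; rewrite ?expr0 // exprS; exact: OM.
apply: (local_bounded_powers KZ (N := n * 2) pp) => k.
by rewrite exprM -NrdX -NrdZ; apply/integral_quat_Nrd/OZ.
Qed.

Lemma local_sqrt (z : K) : z ^+ 2 \in Z -> z \in Z.
Proof.
move=> zZ; have [->|z0] := eqVneq z 0; first exact: rpred0.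
have zV0 : z^-1 != 0 by rewrite invr_eq0.
case: (local_dichotomy KZ zV0) => [|[y yZ e]]; first by rewrite invrK.
case: (local_one_neq_pmul KZ (y := z ^+ 2 * p%:R * y ^+ 2)) => //.
  by move: (z ^+ 2) zZ => t tZ; closed.
transitivity ((z * z^-1) ^+ 2); first by rewrite divff // expr1n.
by rewrite e; ring.
Qed.

End Orders.

Lemma Nrd_integral_order (K : fieldType) (Z : subringClosed K) : local_field 2 Z ->
  Zlattice Z [set x | Nrd x \in Z].
Proof.
move=> KZ; pose e (i : 'I_4) : quat K :=
  nth 0 [:: 1; Quat 0 1 0 0; Quat 0 0 1 0; Quat 2^-1 2^-1 2^-1 2^-1] i.
pose o1 : 'I_4 := lift ord0 ord0; pose o2 : 'I_4 := lift ord0 (lift ord0 ord0).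
pose o3 : 'I_4 := lift ord0 (lift ord0 (lift ord0 ord0)).
have eE (a : 'I_4 -> K) :
    \sum_i a i *: e i = hurwitz_coords (a ord0) (a o1) (a o2) (a o3).
  rewrite !big_ord_recl big_ord0 /e /= quat1E !quatZE /hurwitz_coords.
  rewrite (_ : 0 = Quat 0 0 0 0) // !quatDE !(mulr0, mulr1, addr0, add0r) /=.
  by rewrite ?(addr0, add0r).
pose f (a b c d : K) (i : 'I_4) := nth 0 [:: a; b; c; d] i.
have two_neq0 : 2 != 0 :> K by rewrite (local_natr_eq0 KZ).
exists 4, e; split.
  case=> a b c d; exists (f (a - d) (b - d) (c - d) (2 * d)).
  by rewrite eE /f /=; congr Quat; field.
apply/seteqP; split=> x /=.
  case/(integral_NrdP KZ) => a [b [c [d [[aZ bZ cZ dZ] ->]]]].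
  exists (f a b c d); rewrite eE; split=> // i; rewrite /f.
  by case: i => -[|[|[|[|]]]].
case=> a [aZ ->]; apply/(integral_NrdP KZ); rewrite eE.
by exists (a ord0), (a o1), (a o2), (a o3); split.
Qed.

(** The elements of integral norm are closed under products, form a lattice by their Hurwitz
    coordinates, and contain every order. Hence maximality alone determines [O]. *)
Lemma is_maximal_order_Nrd (O : set (quat (Qp prime2))) x :
  is_maximal_order O -> O x <-> Nrd x \in @Zint prime2.
Proof.
have KZ := Qp_local_field prime2.
move=> [[latO O1 OM] maxO]; have ON y : O y -> Nrd y \in @Zint prime2.
  by apply: (order_integral_Nrd KZ) => //; apply/is_lattice_Zlattice.
split; first exact: ON.
suff <- : [set x | Nrd x \in @Zint prime2] = O by [].
apply: maxO => //; split.
- by apply/is_lattice_Zlattice; apply: Nrd_integral_order KZ.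
- by rewrite /= Nrd1 rpred1.
- by move=> y z /= yZ zZ; rewrite NrdM rpredM.
Qed.

Lemma hurwitzP x : hurwitz x <->
  exists a b c d : int, x = hurwitz_coords a%:~R b%:~R c%:~R d%:~R.
Proof.
suff e (a b c d : int) : a%:~R + b%:~R * D_i + c%:~R * D_j + d%:~R * D_rho =
    hurwitz_coords a%:~R b%:~R c%:~R d%:~R.
  by split=> -[a [b [c [d ->]]]]; exists a, b, c, d.
have ZE (m : int) x0 : m%:~R * x0 = m%:~R *: x0 :> D by rewrite mulrzl scaler_int.
rewrite /D_rho /D_i /D_j /D_k -[a%:~R]mulr1 !ZE quat1E !(quatZE, quatDE). 
by rewrite /hurwitz_coords !(mulr0, mulr1, addr0, add0r); congr Quat; field.
Qed.

(** * Hurwitz quaternions of odd norm that are trivial modulo U^2 *)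

Section OddNorm.
Variables (K : fieldType) (Z : subringClosed K).
Hypothesis KZ : local_field 2 Z.

Let two_neq0 : 2 != 0 :> K. Proof. by rewrite (local_natr_eq0 KZ). Qed.

Lemma local_odd_inv (t : K) : t \in Z -> (1 + 2 * t)^-1 \in Z.
Proof.
move=> tZ; have no y : y \in Z -> 1 + 2 * t <> 2 * y.
  move=> yZ e; apply: (local_one_neq_pmul KZ (y := y - t)) => //; first exact: rpredB.
  by rewrite mulrBr -e addrK.
have u0 : 1 + 2 * t != 0 
  by apply/eqP => e; apply: (no 0); rewrite ?rpred0 // mulr0.
by case: (local_dichotomy KZ u0) => // -[y yZ /no]; case.
Qed.

Lemma local_even_or_odd (z : K) : z \in Z ->
  exists2 w, w \in Z & z = 2 * w \/ z = 1 + 2 * w.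
Proof.
move=> /(local_approx KZ 1)[m [y [yZ ->]]].
case: (int_parity m) => -[k ->]; exists (k%:~R + y); first by closed.
- by left; ring.
- by closed.
- by right; ring.
Qed.

(** The norms of x and of 1 + 2y are 2-adic units, so z^2 and hence z is one, and z = 1 + 2w.
    Therefore z(1 + 2y) is congruent to 1 modulo 2 in Hurwitz coordinates, and its even coordinate
    along rho makes x Lipschitz. *)
Lemma norm_one_mod2_coords (x : D) (n : nat) (z : K) (y : quat K) :
  hurwitz x -> Nrd x = n%:R -> odd n -> Nrd y \in Z ->
  quat_emb K x = z *: (1 + 2 * y) ->
  exists a b c d : int,
    x = Quat (d + 1 + 2 * a)%:~R (d + 2 * b)%:~R (d + 2 * c)%:~R d%:~R.
Proof.
move=> /hurwitzP[A [B [C [E ->]]]] Nn on yN.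
have [a [b [c [d [[aZ bZ cZ dZ] yE]]]]] := integral_Nrd_coords KZ yN.
have two_y : 1 + 2 * y = Quat (1 + 2 * a + d) (2 * b + d) (2 * c + d) d.
  rewrite yE /hurwitz_coords mulr_natl -scaler_nat quat1E quatZE quatDE.
  by congr Quat; field.
rewrite two_y => xE; have := congr1 (@Nrd _) xE.
rewrite (quat_emb_Nrd KZ) Nn (local_ratr_int KZ n) NrdZ -pmulrn.
rewrite (_ : Nrd (Quat _ _ _ _) = 1 + 2 * (2 * a + d + 2 * Nrd y)); last first.
  by rewrite yE Nrd_hurwitz_coords // /Nrd /=; ring.
set t := 2 * a + _ + _ => zn.
have tZ : t \in Z by rewrite /t; move: (Nrd y) yN => N NZ; closed.
have uV := local_odd_inv tZ; have nV : (n%:R : K)^-1 \in Z.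
  by rewrite pmulrn; apply: local_coprime_inv KZ _ _; rewrite dvdzE /= dvdn2 on.
have n0 : n%:R != 0 :> K by rewrite (local_natr_eq0 KZ); case: n on {Nn zn nV}.
have zu0 : z ^+ 2 * (1 + 2 * t) != 0 by rewrite -zn.
have [z0 u0] : z != 0 /\ 1 + 2 * t != 0.
  by move: zu0; rewrite mulf_eq0 sqrf_eq0 negb_or => /andP.
have zZ : z \in Z.
  by apply: (local_sqrt KZ) => //; rewrite -[z ^+ 2](mulfK u0) -zn rpredM ?rpred_nat.
have zVZ : z^-1 \in Z.
  apply: (local_sqrt KZ) => //.
  have -> : z^-1 ^+ 2 = (1 + 2 * t) / n%:R by rewrite zn; field; rewrite z0 u0.
  by rewrite rpredM // rpredD ?rpred1 // rpredM ?rpred_nat.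
have [w wZ [zE|zE]] := local_even_or_odd zZ.
  case: (local_one_neq_pmul KZ (y := w * z^-1)) => //; first by closed.
  by rewrite mulrA -zE divff.
have [x0 x1 x2 x3] : [/\ (2 * A + E)%:~R = 2 * z * (1 + 2 * a + d),
    (2 * B + E)%:~R = 2 * z * (2 * b + d), (2 * C + E)%:~R = 2 * z * (2 * c + d)
    & E%:~R = 2 * (z * d)].
  have halfE (m : int) : ratr (m%:~R / 2) = m%:~R / 2 :> K by rewrite (local_ratr KZ m (b := 2)).
  have sumE (m : int) : ratr (m%:~R + E%:~R / 2) = (2 * m + E)%:~R / 2 :> K.
    by rewrite -halfE intrD intrM; congr ratr; field.
  move: xE; rewrite quatZE /quat_emb /= !sumE halfE => -[x0 x1 x2 x3].
  have dbl (u v : K) : u / 2 = v -> u = 2 * v by move=> <-; field.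
  by rewrite (dbl _ _ x0) (dbl _ _ x1) (dbl _ _ x2) (dbl _ _ x3); split; field.
have dvd2 (m : int) y0 : y0 \in Z -> m%:~R = 2 * y0 -> exists k, m = 2 * k.
  by move=> y0Z e; apply: (local_dvd_pow2 KZ (n := 1) y0Z).
have [e eE] := dvd2 _ _ (rpredM zZ dZ) x3.
have eK : e%:~R = z * d by apply: (mulfI two_neq0); rewrite -x3 eE intrM.
have [b' bE] : exists k, B = 2 * k.
  apply: (dvd2 _ (z * b)); first by closed.
  apply: (mulfI two_neq0); move: x1; rewrite intrD intrM eE intrM eK => x1.
  by apply: (addIr (2 * (z * d))); rewrite x1; ring.
have [c' cE] : exists k, C = 2 * k.
  apply: (dvd2 _ (z * c)); first by closed.
  apply: (mulfI two_neq0); move: x2; rewrite intrD intrM eE intrM eK => x2.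
  by apply: (addIr (2 * (z * d))); rewrite x2; ring.
have [a' aE] : exists k, A - 1 = 2 * k.
  apply: (dvd2 _ (z * a + w)); first by closed.
  apply: (mulfI two_neq0); move: x0; rewrite !(intrD, intrM) eE intrM eK => x0.
  apply: (addIr (2 * (z * d) + 2)); transitivity (2 * A%:~R + 2 * (z * d)); first by ring.
  by rewrite x0 zE; ring.
exists a', b', c', e; rewrite eE bE cE (_ : A = 1 + 2 * a'); last by rewrite -aE; ring.
by rewrite /hurwitz_coords !(intrD, intrM); congr Quat; field.
Qed.

End OddNorm.

(** * Arithmetic of Hurwitz quaternions *)

Lemma quatBE (R : comNzRingType) (a b c d a' b' c' d' : R) :
  Quat a b c d - Quat a' b' c' d' = Quat (a - a') (b - b') (c - c') (d - d').
Proof. by []. Qed.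

Lemma quat_natME (R : comNzRingType) n (a b c d : R) :
  n%:R * Quat a b c d = Quat (n%:R * a) (n%:R * b) (n%:R * c) (n%:R * d).
Proof. by rewrite mulr_natl -scaler_nat. Qed.

Definition hurw : {pred D} := fun x => `[< hurwitz x >].

Lemma hurwP x : reflect
  (exists a b c d : int, x = hurwitz_coords a%:~R b%:~R c%:~R d%:~R) (x \in hurw).
Proof. by apply: (iffP (asboolP _)) => /hurwitzP. Qed.

Fact hurw_subring : subring_closed hurw.
Proof.
split.
- by apply/hurwP; exists 1, 0, 0, 0; rewrite /hurwitz_coords mul0r !addr0.
- move=> x y /hurwP[a [b [c [d ->]]]] /hurwP[e [f [g [h ->]]]].
  apply/hurwP; exists (a - e), (b - f), (c - g), (d - h).
  by rewrite /hurwitz_coords quatBE !intrB; congr Quat; field.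
- move=> x y /hurwP[a [b [c [d ->]]]] /hurwP[e [f [g [h ->]]]].
  apply/hurwP.
  exists (a * e - b * f - c * g - b * g + c * f - b * h - d * g - d * h).
  exists (a * f + b * e - b * g + c * f + d * f + c * h - d * g).
  exists (a * g + c * e - b * g + c * f - b * h + d * f + c * h).
  exists (a * h + d * e + (b * g + b * g) - (c * f + c * f)
          + b * h - d * f - c * h + d * g + d * h).
  rewrite /hurwitz_coords quatME !(intrD, intrB, intrM).
  by congr Quat; field.
Qed.
HB.instance Definition _ := GRing.isSubringClosed.Build D hurw hurw_subring.

Lemma hurw_int_quat (a b c d : int) : (Quat a%:~R b%:~R c%:~R d%:~R : D) \in hurw.
Proof.
apply/hurwP; exists (a - d), (b - d), (c - d), (2 * d).
by rewrite /hurwitz_coords !(intrB, intrM); congr Quat; field.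
Qed.

Lemma hurw_conj x : x \in hurw -> quat_conj x \in hurw.
Proof.
move=> /hurwP[a [b [c [d ->]]]]; apply/hurwP; exists (a + d), (- b), (- c), (- d).
by rewrite /hurwitz_coords /quat_conj /= !(intrD, intrN); congr Quat; field.
Qed.

Lemma hurw_trace x : x \in hurw -> exists t : int, x + quat_conj x = t%:~R%:A.
Proof.
move=> /hurwP[a [b [c [d ->]]]]; exists (2 * a + d).
rewrite /hurwitz_coords /quat_conj quatDE quat1E quatZE /= !(intrD, intrM).
by congr Quat; field.
Qed.

Lemma Nrd_rat_ge0 (x : D) : 0 <= Nrd x.
Proof. by rewrite /Nrd !addr_ge0 ?sqr_ge0. Qed.

Lemma Nrd_rat_eq0 (x : D) : (Nrd x == 0) = (x == 0).
Proof.
apply/eqP/eqP => [|->]; last by rewrite /Nrd /= expr0n !addr0.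
case: x => a b c d; rewrite /Nrd /= => e.
have sq0 (u : rat) : u ^+ 2 = 0 -> u = 0 by move/eqP; rewrite sqrf_eq0 => /eqP.
have [/sq0 -> /sq0 -> /sq0 -> /sq0 -> //] :
    [/\ a ^+ 2 = 0, b ^+ 2 = 0, c ^+ 2 = 0 & d ^+ 2 = 0].
have := (sqr_ge0 a, sqr_ge0 b); have := (sqr_ge0 c, sqr_ge0 d) => -[? ?] [? ?].
by split; lra.
Qed.

Lemma quat_rat_unit (x : D) : (x \is a GRing.unit) = (x != 0).
Proof. by rewrite -Nrd_rat_eq0 -unitfE. Qed.

Lemma quat_ratV (x : D) : x != 0 -> x^-1 = (Nrd x)^-1 *: quat_conj x.
Proof.
rewrite -quat_rat_unit => ux; rewrite -[RHS]mul1r -(mulVr ux) -mulrA -scalerAr quat_mulconj.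
by rewrite scalerA mulVf ?scale1r ?mulr1 // Nrd_rat_eq0 -quat_rat_unit.
Qed.

Lemma hurw_Nrd x : x \in hurw -> exists n : nat, Nrd x = n%:R.
Proof.
move=> /hurwP[a [b [c [d xE]]]].
pose m := a ^+ 2 + b ^+ 2 + c ^+ 2 + (a + b + c) * d + d ^+ 2.
have mE : Nrd x = m%:~R.
  by rewrite xE Nrd_hurwitz_coords // /m !(intrD, intrM, rmorphXn).
have := Nrd_rat_ge0 x; rewrite mE ler0z; case: m {mE} => // n _.
by exists n.
Qed.

Lemma hurw_inv x : Nrd x = 1 -> x \in hurw -> x^-1 \in hurw.
Proof.
move=> x1 hx; have xu : x * quat_conj x = 1 by rewrite quat_mulconj x1 scale1r.
have ux : x \is a GRing.unit by rewrite quat_rat_unit -Nrd_rat_eq0 x1 oner_eq0.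
by rewrite -[x^-1]mulr1 -xu mulKr // hurw_conj.
Qed.

(** Rounding each coordinate leaves four squares of at most 1/4 each. Their sum reaches 1 only if
    every coordinate is a half-odd number, and then [x] is itself Hurwitz. *)
Lemma hurw_euclid (x : D) : exists2 h, h \in hurw & Nrd (x - h) < 1.
Proof.
have round (r : rat) : exists2 m : int, (r - m%:~R) ^+ 2 <= 1 / 4 &
    (r - m%:~R) ^+ 2 = 1 / 4 -> r = m%:~R - 1 / 2.
  exists (Num.floor (r + 1 / 2)); have /andP[] := floor_itv (r + 1 / 2);
    rewrite intrD; move: (_%:~R) => m h1 h2.
    by nra.
  move=> e; have : (r - m - 1 / 2) * (r - m + 1 / 2) = 0 by lra.
  by move/eqP; rewrite mulf_eq0 => /orP[] /eqP; lra.
case: x => a b c d.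
have [[ma a1 a2] [mb b1 b2]] := (round a, round b).
have [[mc c1 c2] [md d1 d2]] := (round c, round d).
have [lt1|ge1] := ltP (Nrd (Quat a b c d - Quat ma%:~R mb%:~R mc%:~R md%:~R)) 1.
  by exists (Quat ma%:~R mb%:~R mc%:~R md%:~R); first exact: hurw_int_quat.
move: ge1; rewrite /Nrd /= => ge1.
exists (Quat a b c d); last first.
  by rewrite /= !subrr.
apply/hurwP; exists (ma - md), (mb - md), (mc - md), (2 * md - 1).
have [/a2 -> /b2 -> /c2 -> /d2 ->] : [/\ (a - ma%:~R) ^+ 2 = 1 / 4,
    (b - mb%:~R) ^+ 2 = 1 / 4, (c - mc%:~R) ^+ 2 = 1 / 4 & (d - md%:~R) ^+ 2 = 1 / 4].
  move: ge1 a1 b1 c1 d1; move: (_ ^+ 2) (_ ^+ 2) (_ ^+ 2) (_ ^+ 2) => u v w t.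
  by split; lra.
by rewrite /hurwitz_coords !(intrB, intrM); congr Quat; field.
Qed.

Lemma hurw_principal (I : set D) (x0 : D) : I x0 -> x0 != 0 ->
  (forall x, I x -> x \in hurw) -> (forall x y, I x -> I y -> I (x - y)) ->
  (forall x b, I x -> b \in hurw -> I (x * b)) ->
  exists2 x, I x & x != 0 /\ forall y, I y -> exists2 b, b \in hurw & y = x * b.
Proof.
move=> Ix0 x00 Ih IB IM.
pose P n := `[< exists x, [/\ I x, x != 0 & Nrd x = n%:R] >].
have exP : exists n, P n.
  by have [n xn] := hurw_Nrd (Ih _ Ix0); exists n; apply/asboolP; exists x0.
case: (ex_minnP exP) => n /asboolP[x [Ix x0' xn]] nmin; exists x => //; split=> // y Iy.
have [b hb lt1] := hurw_euclid (x^-1 * y); exists b => //.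
have ux : x \is a GRing.unit by rewrite quat_rat_unit.
have Ir : I (y - x * b) by apply: IB => //; exact: IM.
have rE : y - x * b = x * (x^-1 * y - b) by rewrite mulrBr mulVKr.
apply/eqP; rewrite -subr_eq0; apply/negPn/negP => r0.
have [k rk] := hurw_Nrd (Ih _ Ir).
have /nmin : P k by apply/asboolP; exists (y - x * b).
rewrite leqNgt => /negP; apply; rewrite -(ltr_nat rat) -rk rE NrdM xn.
rewrite -{2}[n%:R]mulr1 ltr_pM2l // -xn lt_def Nrd_rat_ge0 andbT.
by rewrite Nrd_rat_eq0.
Qed.

(** The norm is odd on 12 of the 16 classes modulo 2, and each of them contains two of the 24 units,
    namely e and -e. *)
Lemma hurw_unit_mod2 y n : y \in hurw -> Nrd y = n%:R -> odd n ->
  exists e h, [/\ e \in hurw, Nrd e = 1, h \in hurw & y = e + 2 * h].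
Proof.
move=> /hurwP[a [b [c [d ->]]]].
rewrite Nrd_hurwitz_coords // => nE on.
have nE' : (n : int) = a ^+ 2 + b ^+ 2 + c ^+ 2 + (a + b + c) * d + d ^+ 2.
  by apply: (@intr_inj rat); rewrite -[LHS]pmulrn -nE !(intrD, intrM, rmorphXn).
have kE : exists k, a ^+ 2 + b ^+ 2 + c ^+ 2 + (a + b + c) * d + d ^+ 2 = 2 * k + 1.
  by exists (n./2 : int); rewrite -nE' -[n in LHS]odd_double_half on; lia.
have split_coords (a1 b1 c1 d1 a2 b2 c2 d2 : int) :
    a1 ^+ 2 + b1 ^+ 2 + c1 ^+ 2 + (a1 + b1 + c1) * d1 + d1 ^+ 2 = 1 ->
    [/\ a = a1 + 2 * a2, b = b1 + 2 * b2, c = c1 + 2 * c2 & d = d1 + 2 * d2] ->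
    exists e h, [/\ e \in hurw, Nrd e = 1, h \in hurw &
      hurwitz_coords a%:~R b%:~R c%:~R d%:~R = e + 2 * h].
  move=> e1 [aE bE cE dE].
  exists (hurwitz_coords a1%:~R b1%:~R c1%:~R d1%:~R).
  exists (hurwitz_coords a2%:~R b2%:~R c2%:~R d2%:~R); split.
  - by apply/hurwP; exists a1, b1, c1, d1.
  - rewrite Nrd_hurwitz_coords //; move/(congr1 (intr : int -> rat)): e1.
    by rewrite !(intrD, intrM, rmorphXn).
  - by apply/hurwP; exists a2, b2, c2, d2.
  rewrite aE bE cE dE /hurwitz_coords quat_natME quatDE !(intrD, intrM).
  by congr Quat; field.
have [[a' [aE|aE]] [b' [bE|bE]]] : (exists a', a = 2 * a' \/ a = 2 * a' + 1) /\
   (exists b', b = 2 * b' \/ b = 2 * b' + 1).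
  by split; [case: (int_parity a) | case: (int_parity b)] => -[k ->]; exists k; auto.
all: have [[c' [cE|cE]] [d' [dE|dE]]] : (exists c', c = 2 * c' \/ c = 2 * c' + 1) /\
   (exists d', d = 2 * d' \/ d = 2 * d' + 1) by
  split; [case: (int_parity c) | case: (int_parity d)] => -[k ->]; exists k; auto.
all: case: kE => k kE; rewrite aE bE cE dE in kE.
(* The four classes of even norm contradict [kE]; each of the other twelve receives an explicit
   unit. *)
all: try by exfalso; clear - kE; lia.
all: clear - split_coords aE bE cE dE.
- by apply: (split_coords 0 0 0 1 a' b' c' d'); split; lia.
- by apply: (split_coords 0 0 1 0 a' b' c' d'); split; lia.
- by apply: (split_coords 0 0 (-1) 1 a' b' (c' + 1) d'); split; lia.
- by apply: (split_coords 0 1 0 0 a' b' c' d'); split; lia.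
- by apply: (split_coords 0 (-1) 0 1 a' (b' + 1) c' d'); split; lia.
- by apply: (split_coords 0 (-1) (-1) 1 a' (b' + 1) (c' + 1) d'); split; lia.
- by apply: (split_coords 1 0 0 0 a' b' c' d'); split; lia.
- by apply: (split_coords (-1) 0 0 1 (a' + 1) b' c' d'); split; lia.
- by apply: (split_coords (-1) 0 (-1) 1 (a' + 1) b' (c' + 1) d'); split; lia.
- by apply: (split_coords (-1) (-1) 0 1 (a' + 1) (b' + 1) c' d'); split; lia.
(* This unit is k = 2 rho - 1 - i - j; the obvious representative 1 + i + j of its class has norm
   3. *)
- by apply: (split_coords (-1) (-1) (-1) 2 (a' + 1) (b' + 1) (c' + 1) (d' - 1)); split; lia.
- by apply: (split_coords (-1) (-1) (-1) 1 (a' + 1) (b' + 1) (c' + 1) d'); split; lia.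
Qed.

Lemma hurw_odd_adjust y n : y \in hurw -> Nrd y = n%:R -> odd n ->
  exists e h, [/\ e \in hurw, Nrd e = 1, h \in hurw & y * e = 1 + 2 * h].
Proof.
move=> hy yn on; have [e [h [he e1 hh yE]]] := hurw_unit_mod2 hy yn on.
exists (quat_conj e), (h * quat_conj e); rewrite rpredM ?hurw_conj //; split=> //.
  by rewrite -e1 /Nrd /= !sqrrN.
by rewrite yE mulrDl quat_mulconj e1 scale1r mulrA.
Qed.

Lemma NrdB_pmul (p : nat) (u b : D) : u \in hurw -> b \in hurw ->
  exists t : int, Nrd (u - p%:R * b) = Nrd u + p%:R * t%:~R.
Proof.
move=> hu hb; have [s sE] := hurw_trace (rpredM hu (hurw_conj hb)).
have [m mE] := hurw_Nrd hb; exists (p%:Z * m%:Z - s).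
have {}sE : s%:~R = q_re (u * quat_conj b + quat_conj (u * quat_conj b)).
  by rewrite sE quat1E quatZE /= mulr1.
rewrite intrB intrM -!pmulrn -mE sE mulr_natl -scaler_nat.
case: u hu {sE} => a1 b1 c1 d1 _; case: b {hb mE} => a2 b2 c2 d2.
by rewrite /Nrd /=; ring.
Qed.

(** Let y generate the right ideal generated by x and p. Since y divides p, its norm is 1, p or p^2.
    The middle value splits off a left factor; the last makes y an associate of p, so that p divides
    x. *)
Lemma hurw_split_prime p m x : prime p -> x \in hurw -> Nrd x = (p ^ m.+1)%:R ->
  (exists2 x', x' \in hurw & x = p%:R *: x') \/
  (exists y x', [/\ y \in hurw, Nrd y = p%:R, x' \in hurw & x = y * x']).
Proof.
move=> pp hx xN; have p0 : p%:R != 0 :> rat by rewrite pnatr_eq0 -lt0n prime_gt0.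
pose I : set D := [set z | exists a b, [/\ a \in hurw, b \in hurw & z = x * a + p%:R * b]].
have Ix : I x by exists 1, 0; rewrite rpred1 rpred0 mulr1 mulr0 addr0.
have Ip : I p%:R by exists 0, 1; rewrite rpred1 rpred0 mulr1 mulr0 add0r.
have x0 : x != 0.
  by rewrite -Nrd_rat_eq0 xN pnatr_eq0 -lt0n expn_gt0 prime_gt0.
have [|||y [a [b [ha hb yE]]] [y0 Iy]] := hurw_principal Ix x0.
- by move=> _ [a [b [ha hb ->]]]; rewrite rpredD ?rpredM ?rpred_nat.
- move=> _ _ [a [b [ha hb ->]]] [c [d [hc hd ->]]]; exists (a - c), (b - d).
  by rewrite !rpredB // !mulrBr; split=> //; rewrite opprD addrACA.
- move=> _ e [a [b [ha hb ->]]] he; exists (a * e), (b * e).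
  by rewrite !rpredM // mulrDl !mulrA.
have hy : y \in hurw by rewrite yE rpredD ?rpredM ?rpred_nat.
have [c hc pE] := Iy _ Ip; have [x' hx' xE] := Iy _ Ix.
have [n nE] := hurw_Nrd hy; have [k kE] := hurw_Nrd hc.
have nk : (n * k = p ^ 2)%N.
  apply/eqP; rewrite -(eqr_nat rat) natrM -nE -kE -NrdM -pE.
  by rewrite Nrd_natr natrX.
have /(dvdn_pfactor _ _ pp)[j j2 nj] : (n %| p ^ 2)%N by rewrite -nk dvdn_mulr.
case: j j2 nj => [|[|[|//]]] _ nj.
(* If Nrd y = 1, then Nrd(x a) = Nrd(y - p b) is 1 modulo p, although p divides Nrd x. *)
- exfalso; have [t tE] := NrdB_pmul p hy hb.
  have [w wE] := hurw_Nrd ha.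
  have : (p%:Z %| 1)%Z.
    apply/dvdzP; exists ((p ^ m)%:Z * w%:Z - t).
      apply: (@intr_inj rat); rewrite mulrC intrM intrB intrM -!pmulrn.
      rewrite mulrBr mulrA -natrM -expnS -xN -wE -NrdM.
      rewrite (_ : x * a = y - p%:R * b); last by rewrite yE addrK.
      by rewrite tE addrK nE nj.
  by rewrite dvdz1 /= => /eqP p1; rewrite p1 in pp.
- by right; exists y, x'; rewrite nE nj expn1.
left; exists (quat_conj c * x'); first by rewrite rpredM ?hurw_conj.
have k1 : k = 1%N.
  move: nk; rewrite nj => /eqP; rewrite -{2}[(p ^ 2)%N]muln1 eqn_pmul2l ?expn_gt0 ?prime_gt0 //.
  by move/eqP.
have yp : y = p%:R * quat_conj c.
  by rewrite pE -mulrA quat_mulconj kE k1 scale1r mulr1.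
by rewrite xE yp scaler_nat -mulrA mulr_natl.
Qed.

(** A left factor z of norm p is moved into [A] by a unit e, and the cofactor absorbs e^-1. Scalar
    factors p form a case of their own: they need no generator because they act trivially on the
    tree. *)
Lemma hurw_prime_power_ind p (A P : D -> Prop) : prime p ->
  (forall z, z \in hurw -> Nrd z = p%:R ->
     exists e, [/\ e \in hurw, Nrd e = 1 & A (z * e)]) ->
  (forall e, e \in hurw -> Nrd e = 1 -> P e) ->
  (forall x, x \in hurw -> P x -> P (p%:R *: x)) ->
  (forall y x, A y -> x \in hurw -> P x -> P (y * x)) ->
  forall m x, x \in hurw -> Nrd x = (p ^ m)%:R -> P x.
Proof.
move=> pp hA P1 Pp PM m; have p0 : p%:R != 0 :> rat by rewrite pnatr_eq0 -lt0n prime_gt0.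
have [n] := ubnP m; elim: n m => // n IH [|m] mn x hx xN; first exact: P1.
case: (hurw_split_prime pp hx xN) => [[x' hx' xE]|[z [x' [hz zN hx' xE]]]].
  rewrite xE; apply: Pp => //.
  have [k kE] := hurw_Nrd hx'.
  have : (p ^ 2 * k = p ^ m.+1)%N.
    by apply/eqP; rewrite -(eqr_nat rat) -xN xE NrdZ kE natrM natrX.
  case: m mn xN => [|m] mn xN.
    move=> e; have : (p * p <= p)%N.
      rewrite -{3}[p]expn1 -e -mulnn leq_pmulr // lt0n; apply: contra_eqN e => /eqP ->.
      by rewrite muln0 expn1 eq_sym -lt0n prime_gt0.
    by rewrite leqNgt -{1}[p]muln1 ltn_pmul2l ?prime_gt0 // prime_gt1.
  rewrite -[m.+2]add2n expnD => /eqP; rewrite eqn_pmul2l ?expn_gt0 ?prime_gt0 // => /eqP ke.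
  by apply: (IH m); [lia | | rewrite kE ke].
have [e [he e1 Aze]] := hA z hz zN.
have ue : e \is a GRing.unit by rewrite quat_rat_unit -Nrd_rat_eq0 e1 oner_eq0.
have hex : e^-1 * x' \in hurw by rewrite rpredM ?hurw_inv.
have -> : x = z * e * (e^-1 * x') by rewrite xE -mulrA mulVKr.
apply: PM => //; apply: (IH m) => //.
have eV1 : Nrd e^-1 = 1 by have := Nrd1 rat; rewrite -(mulVr ue) NrdM e1 mulr1.
rewrite NrdM eV1 mul1r; apply: (mulfI p0).
by rewrite -natrM -expnS -xN xE NrdM zN.
Qed.

(** * The tree at an odd prime *)

Section HomothetyAction.
Variable K : fieldType.
Local Notation V := 'cV[K]_2.
Implicit Types (L : set V) (M N : 'M[K]_2) (v : set (set V)).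

Definition mx_image M L : set V := [set M *m x | x in L].

Lemma dilate_mx (c : K) L : dilate c L = mx_image c%:M L.
Proof. by apply/seteqP; split=> _ [x Lx <-]; exists x; rewrite ?mul_scalar_mx. Qed.

Lemma mx_imageM M N L : mx_image (M *m N) L = mx_image M (mx_image N L).
Proof.
apply/seteqP; split=> [_ [x Lx <-]|_ [_ [x Lx <-] <-]].
  by exists (N *m x); [exists x | rewrite mulmxA].
by exists x; rewrite ?mulmxA.
Qed.

Lemma mx_image1 L : mx_image 1%:M L = L.
Proof.
by apply/seteqP; split=> [_ [x Lx <-]|x Lx]; [|exists x => //]; rewrite mul1mx.
Qed.

Lemma GL2_actM M N v : GL2_act (M *m N) v = GL2_act M (GL2_act N v).
Proof.
apply/seteqP; split=> [_ [L vL <-]|_ [_ [L vL <-] <-]].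
  by exists (mx_image N L); [exists L | rewrite -/(mx_image M _) -mx_imageM].
by exists L => //; rewrite -/(mx_image M _) -/(mx_image N _) -mx_imageM.
Qed.

Lemma GL2_act1 v : GL2_act 1%:M v = v.
Proof.
apply/seteqP; split=> [_ [L vL <-]|L vL]; first by rewrite -/(mx_image _ _) mx_image1.
by exists L; rewrite -?/(mx_image _ _) ?mx_image1.
Qed.

Lemma GL2_act_homothety M L :
  GL2_act M (homothety_class L) = homothety_class (mx_image M L).
Proof.
have mxD c : mx_image M (dilate c L) = dilate c (mx_image M L).
  by rewrite !dilate_mx -!mx_imageM scalar_mxC.
apply/seteqP; split=> [_ [_ [c c0 <-] <-]|_ [c c0 <-]].
  by exists c => //; rewrite -mxD.
by exists (dilate c L); [exists c | rewrite -mxD].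
Qed.

Lemma homothety_self L : homothety_class L L.
Proof. by exists 1 => /=; rewrite ?oner_eq0 // dilate_mx mx_image1. Qed.

Lemma homothety_dilate (c : K) L : c != 0 ->
  homothety_class (dilate c L) = homothety_class L.
Proof.
move=> c0; have dd a b : dilate a (dilate b L) = dilate (a * b) L.
  by rewrite !dilate_mx -mx_imageM -scalar_mxM.
apply/seteqP; split=> _ [d /= d0 <-].
  by rewrite dd; exists (d * c) => //=; rewrite mulf_neq0.
by exists (d / c) => /=; rewrite ?mulf_neq0 ?invr_neq0 // dd mulfVK.
Qed.

End HomothetyAction.

Lemma lattice_absorb p (K : fieldType) (Z : subringClosed K) (V : lmodType K)
    (L M : set V) : local_field p Z -> Zlattice Z L -> Zlattice Z M ->
  exists n, forall v, L v -> M (p%:R ^+ n *: v).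
Proof.
move=> KZ [l [e [_ LE]]] latM; have [m [f [sp ME]]] := latM.
pose c i := projT1 (cid (sp (e i))).
have cE i : e i = \sum_j c i j *: f j by exact: projT2 (cid (sp (e i))).
have [n nP] := local_clear_fin KZ (fun ij : 'I_l * 'I_m => c ij.1 ij.2).
exists n => v; rewrite LE => -[a [aZ ->]].
rewrite scaler_sumr; elim/big_ind: _ => [|x y|i _]; first exact: Zlattice0 latM.
  exact: (ZlatticeD latM).
rewrite scalerA mulrC -scalerA; apply: (ZlatticeZ latM (aZ i)).
rewrite ME cE; exists (fun j => p%:R ^+ n * c i j); split=> [j|].
  exact: (nP (i, j)).
by rewrite scaler_sumr; apply: eq_bigr => j _; rewrite scalerA.
Qed.

(** Multiply the identity z n + conj(z n) = tr(z n) on the left by n. *)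
Lemma quat_sandwich (R : comNzRingType) (n z : quat R) :
  n * z * n = (2 * q_re (z * n)) *: n - Nrd n *: quat_conj z.
Proof.
case: n z => a b c d [a' b' c' d'].
rewrite /quat_conj /Nrd !quatME !quatZE quatBE /=; congr Quat; ring.
Qed.

Lemma quat_average (R : comNzRingType) (x : quat R) :
  Quat 1 0 0 0 * x * quat_conj (Quat 1 0 0 0) + Quat 0 1 0 0 * x * quat_conj (Quat 0 1 0 0)
  + Quat 0 0 1 0 * x * quat_conj (Quat 0 0 1 0) + Quat 0 0 0 1 * x * quat_conj (Quat 0 0 0 1)
  = (4 * q_re x)%:A.
Proof.
case: x => a b c d; rewrite /quat_conj !quatME !quatDE quat1E quatZE /=.
by congr Quat; ring.
Qed.

Section LocalTree.
Variables (p : nat) (K : fieldType) (Z : subringClosed K).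
Hypotheses (KZ : local_field p Z) (pp : prime p) (p_odd : odd p).
Variable phi : {lrmorphism quat K -> 'M[K]_2}.
Hypothesis bij_phi : bijective phi.
Local Notation V := 'cV[K]_2.
Local Notation O := (integral_quat Z).

Let two_neq0 : 2 != 0 :> K. Proof. by rewrite (local_natr_eq0 KZ). Qed.

Let half_Z : 2^-1 \in Z.
Proof.
rewrite [2]pmulrn; apply: local_coprime_inv KZ _ _.
by rewrite dvdzE /= dvdn_prime2 //; apply: contraL p_odd => /eqP ->.
Qed.

Let phiM x y : phi (x * y) = phi x *m phi y. Proof. exact: rmorphM. Qed.
Let phi1 : phi 1 = 1%:M. Proof. exact: rmorph1. Qed.
Let phiZ a x : phi (a *: x) = a *: phi x. Proof. exact: linearZ. Qed.
Let phiB x y : phi (x - y) = phi x - phi y. Proof. exact: rmorphB. Qed.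
Let phi_inj : injective phi. Proof. exact: bij_inj. Qed.

Lemma local_min_valuation (s : seq K) : has (predC1 0) s ->
  exists2 a, a \in s & a != 0 /\ forall b, b \in s -> b / a \in Z.
Proof.
elim: s => //= a s IH; have [/IH[b bs [b0 bP]] _|s0] := boolP (has (predC1 0) s).
  have bZ : exists2 c, c \in a :: s & c != 0 /\ a / c \in Z /\ b / c \in Z.
    have bin : b \in a :: s by rewrite inE bs orbT.
    have [a0|a0] := eqVneq a 0.
      by exists b; rewrite // a0 mul0r rpred0 divff // rpred1.
    case: (local_dichotomy KZ (mulf_neq0 a0 (invr_neq0 b0))) => [|[y yZ e]].
      by rewrite invfM invrK mulrC; exists a; rewrite ?mem_head // divff // rpred1.
    by exists b; rewrite // e divff // rpred1 rpredM // rpred_nat.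
  case: bZ => c cin [c0 [acZ bcZ]]; exists c => //; split=> // x.
  rewrite inE => /predU1P[-> //|/bP xb].
  have -> : x / c = x / b * (b / c) by rewrite mulrA mulfVK.
  exact: rpredM.
rewrite orbF => a0; exists a; rewrite ?mem_head //; split=> // x.
rewrite inE => /predU1P[->|xs]; first by rewrite divff // rpred1.
by move/hasPn: s0 => /(_ _ xs); rewrite negbK => /eqP ->; rewrite mul0r rpred0.
Qed.

(** The preimage of a matrix unit is nonzero of norm 0. Dividing it by twice its coordinate of least
    valuation keeps it integral, because 2 is invertible for odd p. As the norm is symmetric in the
    four coordinates, they may be permuted so that this one becomes the real part, which is then
    1/2. *)
Lemma exists_idempotent : exists n : quat K, [/\ O n, Nrd n = 0 & 2 * q_re n = 1].
Proof.
have [g gK phiK] := bij_phi; pose x := g (delta_mx 0 0).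
have xE : phi x = delta_mx 0 0 by rewrite /x phiK.
have N0 : Nrd x = 0.
  apply/eqP/negPn; rewrite -unitfE; apply/negP => ux.
  have : phi (x * x^-1) = 1%:M by rewrite (mulrV (ux : x \is a GRing.unit)) phi1.
  rewrite phiM xE => /matrixP/(_ 1 1); rewrite mxE big1 => [|i _]; last by rewrite mxE mul0r.
  by rewrite mxE eqxx => /esym/eqP; rewrite oner_eq0.
have x0 : x <> 0.
  move=> x0; move: xE; rewrite x0 rmorph0 => /matrixP/(_ 0 0).
  by rewrite [LHS]mxE [RHS]mxE eqxx => /esym/eqP; rewrite oner_eq0.
case: x N0 x0 {xE} => a b c d N0 x0.
have [|u us [u0 uP]] := @local_min_valuation [:: a; b; c; d].
  apply: contra_notT x0 => /hasPn h; have z y : y \in [:: a; b; c; d] -> y = 0.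
    by move/h; rewrite negbK => /eqP.
  have [-> -> -> ->] : [/\ a = 0, b = 0, c = 0 & d = 0] by
    split; apply: z; rewrite !inE eqxx ?orbT.
  by [].
have mk a' b' c' d' : u = a' -> b' / u \in Z -> c' / u \in Z -> d' / u \in Z ->
    Nrd (Quat a' b' c' d') = 0 -> exists n : quat K, [/\ O n, Nrd n = 0 & 2 * q_re n = 1].
  move=> ua bZ cZ dZ n0; exists ((2^-1 / u) *: Quat a' b' c' d'); split.
  - rewrite quatZE; apply/and4P; rewrite -ua /=.
    have hZ t : t / u \in Z -> 2^-1 / u * t \in Z.
      by move=> tZ; rewrite -mulrA [u^-1 * _]mulrC; exact: rpredM.
    by split; apply: hZ; rewrite // divff // rpred1.
  - by rewrite NrdZ n0 mulr0.
  - by rewrite /= -ua mulfVK // divff.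
have := uP a; have := uP b; have := uP c; have := uP d.
rewrite !inE !eqxx ?orbT => /(_ isT) dZ /(_ isT) cZ /(_ isT) bZ /(_ isT) aZ.
move: us N0; rewrite !inE /Nrd /= => /or4P[] /eqP ue N0.
- exact: (mk a b c d).
- by apply: (mk b a c d) => //; rewrite -N0 /Nrd /=; ring.
- by apply: (mk c a b d) => //; rewrite -N0 /Nrd /=; ring.
- by apply: (mk d a b c) => //; rewrite -N0 /Nrd /=; ring.
Qed.

Definition base_idempotent := projT1 (cid exists_idempotent).
Local Notation n := base_idempotent.

Let n_spec : [/\ O n, Nrd n = 0 & 2 * q_re n = 1].
Proof. exact: projT2 (cid exists_idempotent). Qed.
Let nZ : O n. Proof. by case: n_spec. Qed.

Lemma idempotent_sandwich z : n * z * n = (2 * q_re (z * n)) *: n.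
Proof. by case: n_spec => _ n0 _; rewrite quat_sandwich n0 scale0r subr0. Qed.

Let nn : n * n = n.
Proof.
by have := idempotent_sandwich 1; rewrite mulr1 mul1r; case: n_spec => _ _ ->; rewrite scale1r.
Qed.

Lemma exists_base_vector : exists e : V, e != 0 /\ phi n *m e = e.
Proof.
have phin0 : phi n != 0.
  apply/eqP; rewrite -(rmorph0 phi) => /phi_inj n0; case: n_spec => _ _.
  by rewrite n0 /= mulr0 => /esym/eqP; rewrite oner_eq0.
have [j cj] : exists j, col j (phi n) != 0.
  apply: contra_notP (negP phin0) => /forallNP h; apply/eqP/matrixP => i j.
  by have /negP/negPn/eqP/matrixP/(_ i 0) := h j; rewrite !mxE.
by exists (col j (phi n)); split=> //; rewrite !colE mulmxA -phiM nn.
Qed.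

Definition base_vector := projT1 (cid exists_base_vector).
Local Notation e1 := base_vector.

Let e1_neq0 : e1 != 0. Proof. by case: (projT2 (cid exists_base_vector)). Qed.
Let n_e1 : phi n *m e1 = e1. Proof. by case: (projT2 (cid exists_base_vector)). Qed.

Definition orbit_map (x : quat K) : V := phi x *m e1.
Local Notation act := orbit_map.

Let actM x y : act (x * y) = phi x *m act y.
Proof. by rewrite /act phiM mulmxA. Qed.
Let actD x y : act (x + y) = act x + act y.
Proof. by rewrite /act rmorphD mulmxDl. Qed.
Let actZ a x : act (a *: x) = a *: act x.
Proof. by rewrite /act linearZ -scalemxAl. Qed.

Lemma orbit_map_surj v : exists x, v = act x.
Proof.
have [g gK phiK] := bij_phi.
have [i ei] : exists i, e1 i 0 != 0.
  apply: contra_notP (negP e1_neq0) => /forallNP h; apply/eqP/matrixP => i j.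
  by rewrite ord1 mxE; apply/eqP/negPn/negP.
exists (g (v *m ((e1 i 0)^-1 *: delta_mx 0 i))); rewrite /act phiK -mulmxA.
rewrite (_ : _ *m e1 = 1%:M) ?mulmx1 //; apply/matrixP => j k; rewrite !ord1 -scalemxAl !mxE.
rewrite (bigD1 i) //= big1 => [|l /negPf li]; first by rewrite !mxE !eqxx mul1r addr0 mulVf.
by rewrite !mxE li mul0r.
Qed.

(** Since n fixes e1, another n can be inserted: n z e1 = n z n e1. *)
Lemma orbit_map_idempotent z : act (n * z) = (2 * q_re (z * n)) *: e1.
Proof. by rewrite /act -{1}n_e1 mulmxA -phiM idempotent_sandwich linearZ -scalemxAl n_e1. Qed.

(** Each n z sends e1 to a multiple of e1, so d n z e1 = 0 for all z, and the vectors z e1 fill the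
    plane. *)
Lemma orbit_map_ker d : act d = 0 -> d * n = 0.
Proof.
move=> d0; apply: phi_inj; rewrite rmorph0; apply/matrixP => i j.
have [x xE] := orbit_map_surj (delta_mx j 0).
have : phi (d * n) *m act x = 0.
  by rewrite -actM -mulrA actM orbit_map_idempotent -scalemxAr -/(act d) d0 scaler0.
rewrite -xE => /matrixP/(_ i 0); rewrite !mxE (bigD1 j) //= big1 => [|l /negPf lj].
  by rewrite !mxE !eqxx mulr1 addr0.
by rewrite !mxE lj mulr0.
Qed.

(** An orbit under the integral quaternions is stable under them by construction, whatever the
    splitting is. *)
Definition base_lattice : set V := [set act x | x in O].
Local Notation L0 := base_lattice.

Lemma base_lattice_Zlattice : Zlattice Z L0.
Proof.
(* Four vectors in a plane are allowed: a lattice is given by a spanning family, not by a basis. *)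
pose f (i : 'I_4) := act (nth 0 [:: 1; Quat 0 1 0 0; Quat 0 0 1 0; Quat 0 0 0 1] i).
pose o1 : 'I_4 := lift ord0 ord0; pose o2 : 'I_4 := lift ord0 (lift ord0 ord0).
pose o3 : 'I_4 := lift ord0 (lift ord0 (lift ord0 ord0)).
have fE (a : 'I_4 -> K) : \sum_i a i *: f i = act (Quat (a ord0) (a o1) (a o2) (a o3)).
  rewrite !big_ord_recl big_ord0 addr0 /f -!actZ -!actD /= quat1E !quatZE !quatDE.
  by rewrite !(mulr0, mulr1, addr0, add0r).
pose g (a b c d : K) (i : 'I_4) := nth 0 [:: a; b; c; d] i.
exists 4, f; split=> [v|].
  by have [[a b c d] ->] := orbit_map_surj v; exists (g a b c d); rewrite fE.
apply/seteqP; split=> [_ [[a b c d] /and4P[/= aZ bZ cZ dZ] <-]|_ [a [aZ ->]]].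
  by exists (g a b c d); rewrite fE; split=> // -[[|[|[|[|]]]]].
by rewrite fE; exists (Quat (a ord0) (a o1) (a o2) (a o3)) => //; apply/and4P; split=> /=.
Qed.

Let OM x y : O x -> O y -> O (x * y).
Proof. exact: (@rpredM _ [pred x | O x]). Qed.
Let OD x y : O x -> O y -> O (x + y).
Proof. exact: (@rpredD _ [pred x | O x]). Qed.
Let OZ a x : a \in Z -> O x -> O (a *: x). Proof. exact: integral_quatZ. Qed.

Lemma base_lattice_stable x v : O x -> L0 v -> L0 (phi x *m v).
Proof. by move=> xO [y yO <-]; exists (x * y); rewrite ?actM //; exact: OM. Qed.

Lemma base_lattice_unit x : x \is a GRing.unit -> O x -> O x^-1 ->
  mx_image (phi x) L0 = L0.
Proof.
move=> ux xO xVO; apply/seteqP; split=> [_ [v vL <-]|v vL].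
  exact: base_lattice_stable.
exists (phi x^-1 *m v); first exact: base_lattice_stable.
by rewrite mulmxA -phiM mulrV // phi1 mul1mx.
Qed.

(** For integral b, y b n e1 lies in the lattice, say y b n e1 = c e1 with c integral; then (y b n -
    c) n = 0 gives y b n = c n, which is integral. The sum of b n conj(b) over b = 1, i, j, k is 2
    tr(n) = 2, so y is half the sum of the y b n conj(b). *)
Lemma base_lattice_endo y : (forall v, L0 v -> L0 (phi y *m v)) -> O y.
Proof.
move=> yL; have ybn b : O b -> O (y * b * n).
  move=> bO; have /yL[c cO cE] : L0 (act (b * n)) by exists (b * n) => //; exact: OM.
  have /orbit_map_ker/eqP : act (y * b * n - c) = 0.
    by rewrite /act phiB mulmxBl -!/(act _) cE -actM mulrA subrr.
  by rewrite mulrBl subr_eq0 -[_ * n * n]mulrA nn => /eqP ->; exact: OM.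
have basis : [/\ O (Quat 1 0 0 0), O (Quat 0 1 0 0), O (Quat 0 0 1 0) & O (Quat 0 0 0 1)].
  by split; apply/and4P; rewrite /= !rpred0 rpred1.
case: basis => O1 Oi Oj Ok.
have conjO b : O b -> O (quat_conj b).
  by move=> /and4P[? ? ? ?]; apply/and4P; rewrite /= !rpredN.
have -> : y = 2^-1 *: (y * Quat 1 0 0 0 * n * quat_conj (Quat 1 0 0 0)
    + y * Quat 0 1 0 0 * n * quat_conj (Quat 0 1 0 0)
    + y * Quat 0 0 1 0 * n * quat_conj (Quat 0 0 1 0)
    + y * Quat 0 0 0 1 * n * quat_conj (Quat 0 0 0 1)).
  case: n_spec => _ _ n1; rewrite -!mulrA -!mulrDr !mulrA quat_average.
  rewrite -scalerAr mulr1 scalerA (_ : 4 * _ = 2 * (2 * q_re n)); last by ring.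
  by rewrite n1 mulr1 mulVf // scale1r.
have yb b : O b -> O (y * b * n * quat_conj b) by move=> bO; apply: OM (ybn b bO) (conjO b bO).
by apply: OZ => //; apply: OD; [apply: OD; [apply: OD|]|]; exact: yb.
Qed.

(** Write u = c y where y maps the base lattice onto itself, so that y and y^-1 are integral. Either
    p divides c, or c^-1 is integral; in the latter case u^-1 is integral too, and conj(u) = Nrd(u)
    u^-1 is divisible by p, hence so is u. *)
Lemma stabilizer_base_divisible (u : quat K) (m : int) : O u ->
  Nrd u = (p%:Z * m)%:~R -> m != 0 ->
  GL2_act (phi u) (homothety_class L0) = homothety_class L0 ->
  exists2 w, O w & u = p%:R *: w.
Proof.
move=> uO uN m0; rewrite GL2_act_homothety => e.
have : homothety_class L0 (mx_image (phi u) L0) by rewrite -e; exact: homothety_self.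
case=> c /= c0 cE.
have uN0 : Nrd u != 0.
  rewrite uN (local_intr_eq0 KZ) mulf_neq0 //.
  by rewrite eqz_nat -lt0n prime_gt0.
have uu : u \is a GRing.unit by rewrite -[_ \is a _]/(Nrd u \is a GRing.unit) unitfE.
pose y := c^-1 *: u.
have yL : mx_image (phi y) L0 = L0.
  have -> : phi y = c^-1%:M *m phi u by rewrite mul_scalar_mx phiZ.
  rewrite mx_imageM -cE dilate_mx -mx_imageM -scalar_mxM.
  by rewrite mulVf // mx_image1.
have uy : y \is a GRing.unit.
  rewrite -[_ \is a _]/(Nrd y \is a GRing.unit) unitfE NrdZ.
  by rewrite mulf_neq0 ?expf_neq0 ?invr_neq0.
have yO : O y by apply: base_lattice_endo => v vL; rewrite -yL; exists v.
have yVO : O y^-1.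
  apply: base_lattice_endo => v vL; rewrite -yL in vL; case: vL => w wL <-.
  by rewrite mulmxA -phiM mulVr // phi1 mul1mx.
have uE : u = c *: y by rewrite /y scalerA divff // scale1r.
case: (local_dichotomy KZ c0) => [cV|[c' cZ cp]]; last first.
  by exists (c' *: y); [exact: OZ | rewrite scalerA -cp].
have uVO : O (c^-1 *: y^-1) by exact: OZ.
have uVE : u^-1 = c^-1 *: y^-1 by rewrite uE invrZ // unitfE.
exists (m%:~R *: quat_conj u^-1).
  apply: OZ; first exact: rpred_int.
  by rewrite uVE; case/and4P: uVO => ? ? ? ?; apply/and4P; rewrite /= !rpredN.
have conjE : quat_conj u = Nrd u *: u^-1.
  by rewrite -[LHS](mulrK uu) quat_conjM -scalerAl mul1r.
have conjK (x : quat K) : quat_conj (quat_conj x) = x.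
  by case: x => *; rewrite /quat_conj /= !opprK.
rewrite scalerA -[LHS]conjK conjE uN intrM -pmulrn.
by case: (u^-1) => a b c1 d; rewrite /quat_conj quatZE /=; congr Quat; rewrite ?mulrN.
Qed.

Lemma hurw_integral (x : D) : x \in hurw -> O (quat_emb K x).
Proof.
have ratrZ (m : int) : ratr (m%:~R / 2) \in Z.
  by rewrite (local_ratr KZ m (b := 2)) // rpredM ?rpred_int.
move=> /hurwP[a [b [c [d ->]]]]; apply/and4P.
by split; rewrite /= ?(local_ratrD KZ) ?(local_ratr_int KZ) ?rpredD ?rpred_int ?ratrZ.
Qed.

Lemma integral_quat_approx (w : quat K) N : O w ->
  exists X t, [/\ X \in hurw, O t & w = quat_emb K X + p%:R ^+ N *: t].
Proof.
case: w => a b c d /and4P[/= aZ bZ cZ dZ].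
have [a' [ya [yaZ ea]]] := local_approx KZ N aZ.
have [b' [yb [ybZ eb]]] := local_approx KZ N bZ.
have [c' [yc [ycZ ec]]] := local_approx KZ N cZ.
have [d' [yd [ydZ ed]]] := local_approx KZ N dZ.
exists (Quat a'%:~R b'%:~R c'%:~R d'%:~R), (Quat ya yb yc yd); split.
- exact: hurw_int_quat.
- by apply/and4P.
by rewrite /quat_emb /= !(local_ratr_int KZ) quatZE quatDE -ea -eb -ec -ed.
Qed.

Lemma lattice_sandwich (L : set V) : Zlattice Z L -> exists c N,
  [/\ c != 0, Zlattice Z (dilate c L), dilate c L `<=` L0 &
      forall v, L0 v -> dilate c L (p%:R ^+ N *: v)].
Proof.
move=> latL; have p0 : p%:R != 0 :> K by rewrite (local_natr_eq0 KZ) -lt0n prime_gt0.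
have [l lP] := lattice_absorb KZ latL base_lattice_Zlattice.
have [m mP] := lattice_absorb KZ base_lattice_Zlattice latL.
exists (p%:R ^+ l), (l + m)%N; split.
- by rewrite expf_neq0.
- have [k [e [sp LE]]] := latL; exists k, (fun i => p%:R ^+ l *: e i); split=> [x|].
    have [c cE] := sp (p%:R ^- l *: x); exists c.
    rewrite -[x](scalerKV (a := p%:R ^+ l)) ?expf_neq0 // cE scaler_sumr.
    by apply: eq_bigr => i _; rewrite !scalerA mulrC.
  rewrite LE; apply/seteqP; split=> [_ [_ [a [aZ ->]] <-]|_ [a [aZ ->]]].
    exists a; split=> //; rewrite scaler_sumr.
    by apply: eq_bigr => i _; rewrite !scalerA mulrC.
  exists (\sum_i a i *: e i); first by exists a.
  by rewrite scaler_sumr; apply: eq_bigr => i _; rewrite !scalerA mulrC.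
- by move=> _ [v Lv <-]; exact: lP.
- by move=> v Lv; exists (p%:R ^+ m *: v); [exact: mP | rewrite scalerA -exprD].
Qed.

(* The lattice is encoded by a right ideal of the Hurwitz order, which is principal. *)
Lemma lattice_hurw_orbit (L : set V) : Zlattice Z L ->
  exists x m, [/\ x \in hurw, Nrd x = (p ^ m)%:R &
    homothety_class L = GL2_act (phi (quat_emb K x)) (homothety_class L0)].
Proof.
move=> /lattice_sandwich[c [N [c0 latL' L'L0 L0L']]].
rewrite -(homothety_dilate L c0); move: (dilate c L) latL' L'L0 L0L' => L' latL' L'L0 L0L'.
pose emb := quat_emb K.
pose I : set D := [set x | x \in hurw /\ forall v, L0 v -> L' (phi (emb x) *m v)].
have embN (m : nat) : emb m%:R = m%:R *: 1.
  rewrite /emb -[m%:R]mulr1 mulr_natl -scaler_nat (quat_embZ KZ).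
  by rewrite (local_ratr_int KZ m) (quat_emb1 KZ).
have phiN (m : nat) v : phi (emb m%:R) *m v = m%:R *: v.
  by rewrite embN phiZ -scalemxAl phi1 mul1mx.
have Ip : I (p ^ N)%:R.
  split=> [|v vL]; first exact: rpred_nat.
  by rewrite phiN natrX; exact: L0L'.
have p0 : (p ^ N)%:R != 0 :> D.
  by rewrite -Nrd_rat_eq0 Nrd_natr expf_neq0 // pnatr_eq0 expn_eq0 negb_and -lt0n prime_gt0.
have [x|||x [hx xL] [x0 xP]] := hurw_principal Ip p0.
- by case.
- move=> x y [hx xL] [hy yL]; split=> [|v vL]; first exact: rpredB.
  rewrite /emb (quat_embD KZ) -scaleN1r (quat_embZ KZ) (local_ratr_int KZ (-1)) scaleN1r.
  rewrite phiB mulmxBl -scaleN1r; apply: (ZlatticeD latL'); first exact: xL.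
  by apply: (ZlatticeZ latL'); [rewrite rpredN rpred1 | exact: yL].
- move=> x b [hx xL] hb; split=> [|v vL]; first exact: rpredM.
  rewrite /emb (quat_embM KZ) phiM -mulmxA; apply: xL.
  by apply: base_lattice_stable => //; exact: hurw_integral.
have [b hb pE] := xP _ Ip.
have [m mE] : exists m, Nrd x = (p ^ m)%:R.
  have [[k kE] [l lE]] := (hurw_Nrd hx, hurw_Nrd hb).
  have : (k * l = p ^ (N * 2))%N.
    apply/eqP; rewrite -(eqr_nat rat) natrM -kE -lE -NrdM -pE.
    by rewrite Nrd_natr -natrX expnM.
  move=> kl; have /(dvdn_pfactor _ _ pp)[j _ kj] : (k %| p ^ (N * 2))%N.
    by rewrite -kl dvdn_mulr.
  by exists j; rewrite kE kj.
exists x, m; split=> //; rewrite GL2_act_homothety; congr homothety_class.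
apply/seteqP; split=> [v vL'|_ [v vL <-]]; last exact: xL.
have [y yO yv] := L'L0 v vL'.
(* Replacing y by y n leaves v = y e1 unchanged, but y n sends the whole of the base lattice to
   integral multiples of v, thus into [L']. A Hurwitz approximation of y n modulo p^N then lies in
   the ideal [I]. *)
have wO : O (y * n) := OM yO nZ.
have [X [t [hX tO wE]]] := integral_quat_approx N wO.
have act_n : act n = e1 by [].
have actw : act (y * n) = v by rewrite actM act_n -yv.
have wL u : L0 u -> L' (phi (y * n) *m u).
  case=> z zO <-; rewrite -actM -mulrA actM orbit_map_idempotent -scalemxAr -/(act y) yv.
  apply: (ZlatticeZ latL') => //; rewrite rpredM ?rpred_nat //.
  by have := OM zO nZ; case/and4P.
have IX : I X.
  split=> // u uL; have -> : emb X = y * n - p%:R ^+ N *: t by rewrite wE addrK.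
  rewrite phiB mulmxBl -scaleN1r; apply: (ZlatticeD latL'); first exact: wL.
  apply: (ZlatticeZ latL'); first by rewrite rpredN rpred1.
  by rewrite phiZ -scalemxAl; apply: L0L'; exact: base_lattice_stable.
have [a ha XE] := xP _ IX.
(* With X = x a and p^N = x b, v = (X + p^N t) e1 = x (a + b t) e1. *)
exists (act (emb a * 1 + emb b * t)).
  exists (emb a * 1 + emb b * t) => //.
  by rewrite mulr1; apply: OD; rewrite ?OM ?hurw_integral.
rewrite -actM mulrDr mulr1 mulrA -!(quat_embM KZ) -XE -pE -actw wE.
by rewrite -/(emb _) -/(emb _) embN -scalerAl mul1r natrX.
Qed.

End LocalTree.

(** * Quaternions congruent to 1 or 1 + j + k modulo 2 *)

(** The parity of [c] selects the class, even for 1 and odd for 1 + j + k. One formula for both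
    turns closure properties into polynomial identities. *)
Definition one_or_1jk_mod2 (x : D) : Prop :=
  exists a b c d : int, x = Quat (2 * a + 1)%:~R (2 * b)%:~R c%:~R (c + 2 * d)%:~R.
Local Notation good := one_or_1jk_mod2.

Lemma good1 : good 1.
Proof. by exists 0, 0, 0, 0. Qed.

(** As (1 + j + k)^2 = -1 + 2j + 2k, the two classes form a group of order 2 modulo 2; the witnesses
    come from expanding the product. *)
Lemma goodM x y : good x -> good y -> good (x * y).
Proof.
move=> [a [b [c [d ->]]]] [a' [b' [c' [d' ->]]]].
exists (2 * a * a' + a + a' - 2 * b * b' - c * c' - c * d' - d * c' - 2 * d * d').
exists ((2 * a + 1) * b' + b * (2 * a' + 1) + c * d' - d * c').
exists ((2 * a + 1) * c' - 2 * b * (c' + 2 * d') + c * (2 * a' + 1) + (c + 2 * d) * (2 * b')).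
exists ((2 * a + 1) * d' + b * c' - c * b' + d * (2 * a' + 1) + b * (c' + 2 * d')
  - b' * (c + 2 * d)).
by rewrite quatME -!(intrD, intrM, intrB); congr (Quat _%:~R _%:~R _%:~R _%:~R); ring.
Qed.

Lemma good_conj x : good x -> good (quat_conj x).
Proof.
move=> [a [b [c [d ->]]]]; exists a, (- b), (- c), (- d).
by rewrite /quat_conj /= -!intrN; congr (Quat _%:~R _%:~R _%:~R _%:~R); ring.
Qed.

Lemma lipschitzP x : lipschitz x <-> exists a b c d : int, x = Quat a%:~R b%:~R c%:~R d%:~R.
Proof.
suff e (a b c d : int) : a%:~R + b%:~R * D_i + c%:~R * D_j + d%:~R * D_k =
    Quat a%:~R b%:~R c%:~R d%:~R :> D.
  by split=> -[a [b [c [d ->]]]]; exists a, b, c, d.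
have ZE (m : int) x0 : m%:~R * x0 = m%:~R *: x0 :> D by rewrite mulrzl scaler_int.
rewrite /D_i /D_j /D_k -[a%:~R in LHS]mulr1 !ZE quat1E !(quatZE, quatDE).
by rewrite !(mulr0, mulr1, addr0, add0r).
Qed.

Lemma good_lipschitz x : good x -> lipschitz x /\
  (cong_mod_2lipschitz x 1 \/ cong_mod_2lipschitz x (1 + D_j + D_k)).
Proof.
move=> [a [b [c [d ->]]]]; split.
  by apply/lipschitzP; exists (2 * a + 1), (2 * b), c, (c + 2 * d).
have [[e ->]|[e ->]] := int_parity c; [left | right].
  exists (Quat a%:~R b%:~R e%:~R (e + d)%:~R); first by apply/lipschitzP; exists a, b, e, (e + d).
  by rewrite quat1E quatBE quat_natME !(intrD, intrM); congr Quat; ring.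
exists (Quat a%:~R b%:~R e%:~R (e + d)%:~R); first by apply/lipschitzP; exists a, b, e, (e + d).
have -> : 1 + D_j + D_k = Quat 1 0 1 1 by [].
by rewrite quatBE quat_natME !(intrD, intrM); congr Quat; ring.
Qed.

Lemma good_Nrd x : good x -> exists2 n : nat, Nrd x = n%:R & odd n.
Proof.
move=> [a [b [c [d xE]]]].
have [n nE] : exists n : nat, Nrd x = n%:R.
  by apply: hurw_Nrd; rewrite xE; exact: hurw_int_quat.
exists n => //; have : (n : int) = (2 * a + 1) ^+ 2 + (2 * b) ^+ 2 + c ^+ 2 + (c + 2 * d) ^+ 2.
  by apply: (@intr_inj rat); rewrite -[LHS]pmulrn -nE xE /Nrd /= -!rmorphXn -!intrD.
apply: contraPT => /negPf on; rewrite -[n]odd_double_half on; move: (n./2) => h.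
by rewrite add0n -muln2 PoszM; clear; lia.
Qed.

(** * Integrality of traces of elements of finite order *)

Section Chebyshev.
Variables (f : nat -> rat) (s : rat).
Hypotheses (f0 : f 0%N = 2) (f1 : f 1%N = s).
Hypothesis fS : forall k, f k.+2 = s * f k.+1 - f k.

(** The recursion is that of the traces of w^k for w of norm 1 and trace [s]. For k > 0 these are
    monic integer polynomials of degree k in [s], so after clearing denominators only the power of
    the numerator survives modulo the denominator. *)
Lemma chebyshev_leading m : exists k : int,
  (denq s)%:~R ^+ m.+1 * f m.+1 = ((numq s) ^+ m.+1 + denq s * k)%:~R.
Proof.
have sE : (denq s)%:~R * s = (numq s)%:~R by rewrite mulrC -numqE.
suff h : (exists k : int,
    (denq s)%:~R ^+ m.+1 * f m.+1 = ((numq s) ^+ m.+1 + denq s * k)%:~R) /\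
  (exists k : int, (denq s)%:~R ^+ m.+2 * f m.+2 = ((numq s) ^+ m.+2 + denq s * k)%:~R).
  by case: h.
elim: m => [|m [[k kE] [l lE]]]; split=> //.
- by exists 0; rewrite !expr1 f1 sE mulr0 addr0.
- exists (- 2 * denq s); rewrite fS f0 f1.
  rewrite (_ : _ * _ = ((denq s)%:~R * s) ^+ 2 - (denq s)%:~R * (2 * (denq s)%:~R)); last by ring.
  by rewrite sE !(intrD, intrM, rmorphXn, intrN) /=; ring.
- by exists l.
exists (numq s * l - denq s * (numq s ^+ m.+1 + denq s * k)).
rewrite fS (_ : _ * _ = (denq s)%:~R * s * ((denq s)%:~R ^+ m.+2 * f m.+2)
   - (denq s)%:~R ^+ 2 * ((denq s)%:~R ^+ m.+1 * f m.+1)); last by rewrite !exprS; ring.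
by rewrite sE kE lE !(intrM, intrB, intrD) !rmorphXn /= !exprS; ring.
Qed.

Lemma chebyshev_integral m : f m.+1 = 2 -> exists c : int, s = c%:~R.
Proof.
move=> fm; have [k] := chebyshev_leading m; rewrite fm -rmorphXn -[2]/(2%:~R) -intrM.
move/intr_inj => e; exists (numq s).
have : (denq s %| numq s ^+ m.+1)%Z.
  have -> : numq s ^+ m.+1 = denq s * (denq s ^+ m * 2 - k).
    by rewrite mulrBr mulrA -exprS e addrK.
  exact: dvdz_mulr.
have cop : coprimez (denq s) (numq s ^+ m.+1).
  by apply: coprimezXr; rewrite coprimez_sym coprimezE coprime_num_den.
rewrite -[numq s ^+ m.+1]mulr1 Gauss_dvdzr // dvdz1 => /eqP d1.
have d1' : denq s = 1 by rewrite -[LHS]gez0_abs ?d1 // denq_ge0.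
by rewrite -[LHS]divq_num_den d1' divr1.
Qed.

End Chebyshev.

(* The trace of w = x^2 / Nrd x is a sum of two conjugate roots of unity, hence an integer. *)
Lemma good_torsion x n z : good x -> x ^+ n.+1 = z%:A -> exists t : rat, x = t%:A.
Proof.
move=> gx xn; have [N NE Nodd] := good_Nrd gx.
case: gx xn NE => a [b [c [d xE]]] xn NE.
have N0 : N%:R != 0 :> rat by rewrite pnatr_eq0; case: N Nodd {NE}.
set A := 2 * a + 1; pose w : D := (N%:R)^-1 *: x ^+ 2.
have NE' : (N : int) = A ^+ 2 + (2 * b) ^+ 2 + c ^+ 2 + (c + 2 * d) ^+ 2.
  by apply: (@intr_inj rat); rewrite -[LHS]pmulrn -NE xE /Nrd /= -!rmorphXn -!intrD.
have w1 : Nrd w = 1 by rewrite NrdZ NrdX NE -exprMn mulVf // expr1n.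
have CH (y : D) : y ^+ 2 = (2 * q_re y) *: y - (Nrd y)%:A.
  case: y => y0 y1 y2 y3; rewrite expr2 quatME quatZE quat1E quatZE quatBE /Nrd /=.
  by congr Quat; ring.
have reD (y y' : D) : q_re (y - y') = q_re y - q_re y' by [].
have reZ (t : rat) (y : D) : q_re (t *: y) = t * q_re y by [].
pose s : rat := 2 * q_re w; pose f k := 2 * q_re (w ^+ k).
have fS k : f k.+2 = s * f k.+1 - f k.
  have w2 : w ^+ 2 = s *: w - 1 by rewrite CH w1 scale1r.
  have wk : w ^+ k.+2 = s *: w ^+ k.+1 - w ^+ k.
    by rewrite -[k.+2]addn2 exprD w2 mulrBr mulr1 -scalerAr -exprSr.
  by rewrite /f wk reD reZ; ring.
(* [w ^+ n.+1] is a scalar of norm 1, possibly -1; doubling the exponent makes it 1. *)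
have f2n : f (n.+1 * 2)%N = 2.
  have wz : w ^+ n.+1 = ((N%:R)^-1 ^+ n.+1 * z ^+ 2)%:A.
    by rewrite exprZn -exprM mulnC exprM xn exprZn expr1n scalerA.
  have : Nrd (w ^+ n.+1) = 1 by rewrite NrdX w1 expr1n.
  rewrite /f exprM wz NrdZ Nrd1 mulr1 => e.
  by rewrite exprZn e expr1n scale1r /= mulr1.
have [cs sE] : exists c : int, s = c%:~R.
  have f0 : f 0%N = 2 by rewrite /f expr0 /= mulr1.
  exact: (chebyshev_integral f0 (erefl : f 1%N = s) fS (f2n : f (n * 2).+2 = 2)).
have eq4 : (cs + 2) * N = 4 * A ^+ 2.
  apply: (@intr_inj rat); rewrite intrM intrD -sE -pmulrn.
  have -> : s = 2 * ((N%:R)^-1 * (2 * A%:~R ^+ 2 - N%:R)).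
    rewrite /s /w reZ CH reD !reZ NE; congr (2 * (_ * _)); rewrite xE /= mulr1 -/A. ring.
  by rewrite intrM rmorphXn /=; field.
have [c' c'E] : exists c', cs + 2 = 4 * c'.
  have : (4 %| cs + 2)%Z.
    rewrite -(@Gauss_dvdzl 4 (cs + 2) N) ?eq4 ?dvdz_mulr //.
    by rewrite coprimezE /= (coprimeXl 2 (m := 2)) // coprime2n.
  by move=> /dvdzP[c' ->]; exists c'; rewrite mulrC.
have AE : c' * N = A ^+ 2 by lia.
have A0 : 0 < A ^+ 2 by rewrite exprn_even_gt0 //= /A; lia.
(* From c' N = A^2 and N >= A^2 > 0. *)
have c1 : c' = 1.
  have := sqr_ge0 b; have := sqr_ge0 c; have := sqr_ge0 (c + 2 * d) => h1 h2 h3.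
  have N_ge : A ^+ 2 <= N by rewrite NE'; lia.
  have : 0 < c' by rewrite -(pmulr_lgt0 _ (lt_le_trans A0 N_ge)) AE.
  have : c' < 2 by rewrite -(ltr_pM2r (lt_le_trans A0 N_ge)) AE; lia.
  by lia.
have [b0 c0 d0] : [/\ b = 0, c = 0 & c + 2 * d = 0].
  have e : 4 * b ^+ 2 + c ^+ 2 + (c + 2 * d) ^+ 2 = 0 by move: AE; rewrite c1 mul1r NE'; lia.
  have h1 := sqr_ge0 b; have h2 := sqr_ge0 c; have h3 := sqr_ge0 (c + 2 * d).
  have sq0 (u : int) : u ^+ 2 = 0 -> u = 0 by move/eqP; rewrite sqrf_eq0 => /eqP.
  by split; apply: sq0; lia.
by exists A%:~R; rewrite xE d0 b0 c0 quat1E quatZE mulr1 !mulr0.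
Qed.

Section BaseVertex.
Variable p : prime_nat.
Hypothesis p_odd : odd p.
Variable phi : {lrmorphism quat (Qp p) -> 'M[Qp p]_2}.
Hypothesis bij_phi : bijective phi.

(** This is all that the global argument uses of the tree at p. It speaks of rational quaternions
    only, so that p-adic scalars do not reappear. *)
Definition base_vertex_spec (v0 : set (set 'cV[Qp p]_2)) : Prop :=
  [/\ tree_vertex v0,
      forall x n, x \in hurw -> Nrd x = n%:R -> ~~ (p %| n)%N ->
        GL2_act (phi (quat_Qp p x)) v0 = v0,
      forall a b c d m : int, let x := Quat a%:~R b%:~R c%:~R d%:~R in
        Nrd x = (p%:Z * m)%:~R -> m != 0 -> GL2_act (phi (quat_Qp p x)) v0 = v0 ->
        [/\ (p%:Z %| a)%Z, (p%:Z %| b)%Z, (p%:Z %| c)%Z & (p%:Z %| d)%Z] &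
      forall v, tree_vertex v -> exists x m,
        [/\ x \in hurw, Nrd x = (p ^ m)%:R & v = GL2_act (phi (quat_Qp p x)) v0]].

Lemma exists_base_vertex : exists v0, base_vertex_spec v0.
Proof.
have KZ := Qp_local_field p; have pp := p_prime p.
pose L0 := base_lattice KZ pp p_odd bij_phi.
exists (homothety_class L0); split.
- by exists L0 => //; apply/is_lattice_Zlattice; exact: base_lattice_Zlattice.
- move=> x n hx xn pn; rewrite GL2_act_homothety; congr homothety_class.
  have n0 : n%:R != 0 :> rat.
    by rewrite pnatr_eq0; apply: contra pn => /eqP ->; rewrite dvdn0.
  have ux : x \is a GRing.unit by rewrite quat_rat_unit -Nrd_rat_eq0 xn.
  have xV : x^-1 = n%:R^-1 *: quat_conj x by rewrite quat_ratV ?xn // -quat_rat_unit.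
  apply: base_lattice_unit; first exact: (quat_emb_unit KZ ux).
    exact: (hurw_integral KZ pp p_odd hx).
  rewrite -(quat_embV KZ ux) xV (quat_embZ KZ); apply: integral_quatZ.
    have -> : ratr n%:R^-1 = (n%:~R)^-1 :> Qp p.
      by have := local_ratr KZ 1 (b := n); rewrite !mul1r => -> //; move: n0; rewrite pnatr_eq0.
    by apply: (local_coprime_inv KZ).
  exact: (hurw_integral KZ pp p_odd (hurw_conj hx)).
- move=> a b c d m x xN m0 fix_v0.
  have hx : x \in hurw by exact: hurw_int_quat.
  have [|[a' b' c' d'] /and4P[/= aZ bZ cZ dZ] e] :=
    stabilizer_base_divisible (hurw_integral KZ pp p_odd hx) _ m0 fix_v0.
    by rewrite (quat_emb_Nrd KZ) xN (local_ratr_int KZ).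
  case: e; rewrite !(local_ratr_int KZ) => e1 e2 e3 e4.
  split; [exact: (local_dvdz KZ aZ e1) | exact: (local_dvdz KZ bZ e2)
    | exact: (local_dvdz KZ cZ e3) | exact: (local_dvdz KZ dZ e4)].
- move=> _ [L /is_lattice_Zlattice latL ->].
  exact: (lattice_hurw_orbit KZ pp p_odd bij_phi latL).
Qed.

End BaseVertex.

Lemma tree_vertex_GL2 (p : prime_nat) (M N : 'M[Qp p]_2) v :
  M *m N = 1%:M -> tree_vertex v -> tree_vertex (GL2_act M v).
Proof.
move=> MN [L /is_lattice_Zlattice [n [e [sp LE]]] ->].
exists (mx_image M L); last exact: GL2_act_homothety.
apply/is_lattice_Zlattice; exists n, (fun i => M *m e i).
have sumE (a : 'I_n -> Qp p) : M *m (\sum_i a i *: e i) = \sum_i a i *: (M *m e i).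
  by rewrite mulmx_sumr; apply: eq_bigr => i _; rewrite scalemxAr.
split=> [x|].
  by have [c cE] := sp (N *m x); exists c; rewrite -sumE -cE mulmxA MN mul1mx.
rewrite LE; apply/seteqP; split=> [_ [_ [a [aZ ->]] <-]|_ [a [aZ ->]]].
  by exists a; rewrite sumE.
by exists (\sum_i a i *: e i); [exists a | rewrite sumE].
Qed.

(** * Parity patterns of the generators *)

Section GeneratorSets.
Variable O2 : set (quat (Qp prime2)).
Hypothesis hO2 : is_maximal_order O2.
Variable p : prime_nat.
Hypothesis p_odd : odd p.

Let KZ2 := Qp_local_field prime2.

Lemma A_set_coords x : A_set O2 p x -> exists a b c d : int,
  x = Quat (d + 1 + 2 * a)%:~R (d + 2 * b)%:~R (d + 2 * c)%:~R d%:~R.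
Proof.
move=> [hx xN [z [u [z0 [y yO2 <-] xE]]]].
exact: (norm_one_mod2_coords KZ2 hx xN p_odd ((is_maximal_order_Nrd y hO2).1 yO2) xE).
Qed.

Lemma A'_set_hurw x : A'_set O2 p x -> x \in hurw /\ Nrd x = p%:R.
Proof.
rewrite /A'_set; case: ifP => _ [].
  by move=> hx xN _; split=> //; apply/asboolP.
move=> y [hy yN _] <-; split.
  by rewrite rpredM //; [apply/asboolP | exact: (hurw_int_quat 0 1 0 0)].
by rewrite NrdM yN (_ : Nrd D_i = 1) ?mulr1.
Qed.

(** In the coordinates of [A_set_coords] the norm is 1 modulo 4 for even d and 3 for odd d. So p
    modulo 4 decides between the patterns 1 and i + j + k, and (i + j + k) i = -1 + j - k accounts
    for the twist by i. *)
Lemma A'_set_good x : A'_set O2 p x -> one_or_1jk_mod2 x.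
Proof.
have norm_eq (y : D) (a b c d : int) : Nrd y = p%:R ->
    y = Quat (d + 1 + 2 * a)%:~R (d + 2 * b)%:~R (d + 2 * c)%:~R d%:~R ->
    (p : int) = (d + 1 + 2 * a) ^+ 2 + (d + 2 * b) ^+ 2 + (d + 2 * c) ^+ 2 + d ^+ 2.
  move=> yN yE; apply: (@intr_inj rat).
  by rewrite -[LHS]pmulrn -yN yE /Nrd /= -!rmorphXn -!intrD.
have p4 : (p : int) = (p %/ 4)%N * 4 + (p %% 4)%N by rewrite {1}(divn_eq p 4).
rewrite /A'_set; case: ifP => [/eqP p1 Ax|p1 [y Ay <-]].
  have [a [b [c [d xE]]]] := A_set_coords Ax; case: Ax => _ xN _.
  have := norm_eq _ _ _ _ _ xN xE; rewrite p4 p1.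
  case: (int_parity d) xE => -[e ->] xE pE; last by exfalso; lia.
  exists (e + a), (e + b), (2 * e + 2 * c), (- c).
  by rewrite xE; congr (Quat _%:~R _%:~R _%:~R _%:~R); ring.
have [a [b [c [d yE]]]] := A_set_coords Ay; case: Ay => _ yN _.
have := norm_eq _ _ _ _ _ yN yE; rewrite p4.
case: (int_parity d) yE => -[e ->] yE pE.
  exfalso; have : (p %% 4 < 4)%N by rewrite ltn_mod.
  by move: p1 pE; case: (p %% 4)%N => [|[|[|[|]]]] // _ pE _; lia.
exists (- e - b - 1), (e + 1 + a), (2 * e + 1), (- 2 * e - 1 - c).
rewrite yE /D_i quatME !(mulr0, mulr1, subr0, add0r, addr0, sub0r) -!intrN.
by congr (Quat _%:~R _%:~R _%:~R _%:~R); ring.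
Qed.

Lemma A'_set_adjust z : z \in hurw -> Nrd z = p%:R ->
  exists e, [/\ e \in hurw, Nrd e = 1 & A'_set O2 p (z * e)].
Proof.
move=> hz zN; have [e [h [he e1 hh zeE]]] := hurw_odd_adjust hz zN p_odd.
have Aze : A_set O2 p (z * e).
  split; first by apply/asboolP; apply: (rpredM hz he).
    by rewrite NrdM zN e1 mulr1.
  exists 1, (1 + 2 * quat_Qp prime2 h); split; first exact: oner_neq0.
    exists (quat_Qp prime2 h) => //; apply/(is_maximal_order_Nrd _ hO2).
    rewrite -[quat_Qp _ _]/(quat_emb _ _) (quat_emb_Nrd KZ2).
    have [n ->] := hurw_Nrd hh; rewrite (local_ratr_int KZ2 n); exact: rpred_int.
  rewrite scale1r zeE -[quat_Qp _ _]/(quat_emb _ _) (quat_embD KZ2) (quat_emb1 KZ2).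
  rewrite (quat_embM KZ2); congr (_ + _ * _).
  by rewrite -[2]scaler_nat (quat_embZ KZ2) (local_ratr_int KZ2 2) (quat_emb1 KZ2) scaler_nat.
have hi : D_i \in hurw by exact: (hurw_int_quat 0 1 0 0).
rewrite /A'_set; case: ifP => _; first by exists e.
exists (e * D_i); split; first exact: rpredM.
  by rewrite NrdM e1 mul1r.
by exists (z * e); rewrite ?mulrA.
Qed.

End GeneratorSets.

(** * The group Gamma' and its action *)

Section SUnits.
Variable S : {fset place}.

Lemma hurwitzSP x : hurwitzS S x <-> exists a b c d,
  [/\ ZS S a, ZS S b, ZS S c & ZS S d] /\ x = hurwitz_coords a b c d.
Proof.
suff e (a b c d : rat) : a%:A + b *: D_i + c *: D_j + d *: D_rho = hurwitz_coords a b c d.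
  by split=> -[a [b [c [d [h ->]]]]]; exists a, b, c, d.
rewrite /D_rho /D_i /D_j /D_k quat1E !(quatZE, quatDE) /hurwitz_coords /=.
by congr Quat; field.
Qed.

Lemma ZS_nat (n : nat) : ZS S n%:R. Proof. by rewrite pmulrn; exact: ZS_int. Qed.

Lemma S_number_unit n : S_number S n -> ZS_unit S n%:R.
Proof.
move=> Sn; have n0 := S_number_neq0 Sn; split=> //; first exact: ZS_nat.
by exists n, 1; rewrite mul1r.
Qed.

Lemma hurw_hurwitzS x : x \in hurw -> hurwitzS S x.
Proof.
move=> /hurwP[a [b [c [d ->]]]]; apply/hurwitzSP.
by exists a%:~R, b%:~R, c%:~R, d%:~R; split; first by split; exact: ZS_int.
Qed.

Lemma hurwitzS_scalar (t : rat) : hurwitzS S t%:A <-> ZS S t.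
Proof.
split=> [/hurwitzSP[a [b [c [d [[aS _ _ _]]]]]]|tS]; last first.
  have := ZS_int S 0 => h0; apply/hurwitzSP; exists t, 0, 0, 0; split=> //.
  by rewrite quat1E quatZE /hurwitz_coords mulr1 !mulr0 mul0r !addr0.
rewrite quat1E quatZE /hurwitz_coords mulr1 !mulr0 => -[e1 _ _ e4].
by rewrite e1 -e4 addr0.
Qed.

Lemma hurwitzSZ (t : rat) x : ZS S t -> hurwitzS S x -> hurwitzS S (t *: x).
Proof.
by move=> tS xS; rewrite -[x]mul1r scalerAl; apply: hurwitzSM => //; apply/hurwitzS_scalar.
Qed.

Lemma hurwitzS_Nrd x : hurwitzS S x -> ZS S (Nrd x).
Proof.
move=> /hurwitzSP[a [b [c [d [[aS bS cS dS] ->]]]]].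
rewrite Nrd_hurwitz_coords // !expr2.
by repeat first [assumption | apply: ZSD | apply: ZSM].
Qed.

Lemma hurw_hurwitzS_unit x n :
  x \in hurw -> Nrd x = n%:R -> S_number S n -> is_hurwitzS_unit S x.
Proof.
move=> hx xn Sn; have [n0 nS nVS] := S_number_unit Sn.
have ux : x \is a GRing.unit by rewrite quat_rat_unit -Nrd_rat_eq0 xn.
split=> //; first exact: hurw_hurwitzS.
have -> : x^-1 = n%:R^-1 *: quat_conj x by rewrite quat_ratV ?xn // -quat_rat_unit.
by apply: hurwitzSZ => //; apply: hurw_hurwitzS; exact: hurw_conj.
Qed.

(** The norm of the inverse is 1/n and equals k/l for an S-number l; then l = k n, so the primes
    dividing n divide l. *)
Lemma hurwitzS_unit_prime (u : hurwitzS_unit S) n (q : prime_nat) :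
  Nrd (val u) = n%:R -> (q %| n)%N -> fin_place q \in S.
Proof.
move=> un qn; have [_ uu /hurwitzS_Nrd] := hurwitzS_unitP u.
have n0 : n%:R != 0 :> rat.
  by rewrite -un Nrd_rat_eq0 -quat_rat_unit.
have -> : Nrd (val u)^-1 = n%:R^-1.
  by apply: (mulfI n0); rewrite -{1}un -NrdM mulrV // Nrd1 divff.
move=> [l [k [[l0 lS] e]]]; apply: lS.
have lk : (l : int) = k * n.
  have l0' : l%:R != 0 :> rat by rewrite pnatr_eq0 -lt0n.
  apply: (@intr_inj rat); rewrite intrM -!pmulrn; apply: (mulIf (invr_neq0 l0')).
  by rewrite divff // mulrAC -e mulVf.
have : (q%:Z %| l%:Z)%Z by rewrite lk dvdz_mull.
by [].
Qed.

Lemma Lambda_class_scalar (u : hurwitzS_unit S) (t : rat) :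
  val u = t%:A -> Lambda_class u = 1%g.
Proof.
move=> ut; have [uS uu uVS] := hurwitzS_unitP u.
have t0 : t != 0.
  by move: uu; rewrite ut quat_rat_unit -Nrd_rat_eq0 NrdZ Nrd1 mulr1 sqrf_eq0.
apply/Lambda_classP; exists t => //; split=> //; apply/hurwitzS_scalar; rewrite -?ut //.
by move: uVS; rewrite ut invrZ ?invr1 ?unitr1 // unitfE.
Qed.

Lemma prime_in_S (p : S0_prime S) : fin_place (val p) \in S.
Proof. by case: p => p /= /fsetDP[]. Qed.

Lemma S0_prime_odd (p : S0_prime S) : odd (val p).
Proof.
case: p => p /= /fsetDP[_]; rewrite !inE negb_or => /andP[p2 _].
case: (even_prime (p_prime p)) => // e; case/eqP: p2.
by congr Some; apply: val_inj.
Qed.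

Lemma S0_primeP (q : prime_nat) : fin_place q \in S -> odd q ->
  exists p : S0_prime S, val p = q.
Proof.
move=> qS oq; have h : fin_place q \in (S `\` ramified_places)%fset.
  rewrite in_fsetD qS andbT !inE negb_or andbT; apply/eqP => -[] e.
  by rewrite e in oq.
by exists (exist (fun p => is_true (fin_place p \in (S `\` ramified_places)%fset)) q h).
Qed.

Lemma S0_prime_enum : exists s : seq (S0_prime S), forall p, p \in s.
Proof.
exists (pmap (fun x : place => obind (fun q : prime_nat => insub q) x) (enum_fset S)) => p.
rewrite mem_pmap; apply/mapP; exists (fin_place (val p)); first exact: prime_in_S.
by rewrite /= valK.
Qed.

Lemma S0_prime_number (p : S0_prime S) : S_number S (val p).
Proof.
split=> [|q]; first exact: p_gt0.
rewrite dvdn_prime2 ?p_prime // => /eqP e.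
have -> : q = val p by exact: val_inj.
exact: prime_in_S.
Qed.

End SUnits.

Section Action.
Variable S : {fset place}.
Variable phi : forall p : S0_prime S, {lrmorphism quat (Qp (val p)) -> 'M[Qp (val p)]_2}.
Local Notation vertices := (forall p : S0_prime S, set (set 'cV[Qp (val p)]_2)).

(** [Lambda_act] passes through a chosen representative. Acting by quaternions gives strict
    multiplicativity and also covers Hurwitz quaternions that are not S-units. *)
Definition unit_act (x : D) (v : vertices) : vertices :=
  fun p => GL2_act (phi p (quat_Qp (val p) x)) (v p).

Arguments unit_act _ _ _ : clear implicits.

Lemma unit_actM x y v : unit_act (x * y) v = unit_act x (unit_act y v).
Proof.
apply/functional_extensionality_dep => p; rewrite /unit_act -GL2_actM.
by rewrite -[quat_Qp _ (x * y)]/(quat_emb _ _) (quat_embM (Qp_local_field _)) rmorphM.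
Qed.

Lemma unit_act1 v : unit_act 1 v = v.
Proof.
apply/functional_extensionality_dep => p; rewrite /unit_act.
rewrite -[quat_Qp _ _]/(quat_emb _ _) (quat_emb1 (Qp_local_field _)) rmorph1.
exact: GL2_act1.
Qed.

Lemma unit_act_vertex x v : x \is a GRing.unit -> cube_vertex v -> cube_vertex (unit_act x v).
Proof.
move=> ux hv p; apply: (tree_vertex_GL2 (N := phi p (quat_Qp (val p) x^-1))) (hv p).
rewrite -[_ *m _]/(_ * _) -rmorphM -[quat_Qp _ x]/(quat_emb _ _) -[quat_Qp _ _]/(quat_emb _ _).
by rewrite -(quat_embM (Qp_local_field _)) mulrV // (quat_emb1 (Qp_local_field _)) rmorph1.
Qed.

Lemma unit_actZ (t : rat) x v : t != 0 -> cube_vertex v -> unit_act (t *: x) v = unit_act x v.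
Proof.
move=> t0 hv; apply/functional_extensionality_dep => p; rewrite /unit_act quat_QpZ linearZ.
by have [L _ ->] := hv p; rewrite GL2_act_scale // ratr_Qp_eq0.
Qed.

Lemma Lambda_act_vertex g v : cube_vertex v -> cube_vertex (Lambda_act phi g v).
Proof. by move=> hv; apply: unit_act_vertex => //; have [] := hurwitzS_unitP (repr g). Qed.

Lemma Lambda_act_unit u v : cube_vertex v ->
  Lambda_act phi (Lambda_class u) v = unit_act (val u) v.
Proof. exact: Lambda_act_class. Qed.

Lemma Lambda_class_mulg (u w : hurwitzS_unit S) :
  (Lambda_class u * Lambda_class w)%g = Lambda_class (u * w)%g.
Proof. exact: (Lambda_classM u w). Qed.

Lemma unit_act_mulg (u w : hurwitzS_unit S) v :
  unit_act (val (u * w)%g) v = unit_act (val u) (unit_act (val w) v).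
Proof. exact: (unit_actM (val u) (val w) v). Qed.

Lemma Lambda_actM g h v : cube_vertex v ->
  Lambda_act phi (g * h)%g v = Lambda_act phi g (Lambda_act phi h v).
Proof.
move=> hv; elim/Lambda_ind: g => u; elim/Lambda_ind: h => w.
rewrite Lambda_class_mulg (Lambda_act_unit _ hv).
rewrite (Lambda_act_unit _ (Lambda_act_vertex _ hv)) (Lambda_act_unit _ hv).
exact: unit_actM.
Qed.

Lemma Lambda_act1 v : cube_vertex v -> Lambda_act phi 1%g v = v.
Proof.
move=> hv; have -> : 1%g = Lambda_class 1%g :> Lambda S by [].
rewrite (Lambda_act_unit _ hv); exact: unit_act1.
Qed.

End Action.
Arguments unit_act {S} phi x v p.

Section GammaGroup.
Variables (S : {fset place}) (O2 : set (quat (Qp prime2))).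
Hypothesis hO2 : is_maximal_order O2.
Local Notation Gamma := (@Gamma' O2 S).

Lemma Gamma'_subgroup : is_subgroup Gamma.
Proof.
split=> [H [] //|x y Gx Gy H subH gH|x Gx H subH gH]; have [_ HM HV] := subH.
  by apply: HM; [exact: Gx | exact: Gy].
by apply: HV; exact: Gx.
Qed.

Lemma Gamma'_gen (p : S0_prime S) (u : hurwitzS_unit S) :
  A'_set O2 (val p) (val u) -> Gamma (Lambda_class u).
Proof. by move=> Au H subH; apply; exists p => //; exists u. Qed.

Lemma hurwitzS_unitZ (z : rat) (u : hurwitzS_unit S) :
  ZS_unit S z -> is_hurwitzS_unit S (z *: val u).
Proof.
move=> [z0 zS zVS]; have [uS uu uVS] := hurwitzS_unitP u.
split; first exact: hurwitzSZ.
  by rewrite quat_rat_unit scaler_eq0 negb_or z0 -quat_rat_unit.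
by rewrite invrZ ?unitfE //; exact: hurwitzSZ.
Qed.

Lemma Gamma'_good g : Gamma g ->
  exists2 u : hurwitzS_unit S, Lambda_class u = g & one_or_1jk_mod2 (val u).
Proof.
move=> Gg; pose H : set (Lambda S) :=
  [set g | exists2 u : hurwitzS_unit S, Lambda_class u = g & one_or_1jk_mod2 (val u)].
apply: (Gg H) => [|_ [p _ [u Au ->]]]; last first.
  by exists u => //; exact: (A'_set_good hO2 (S0_prime_odd p) Au).
split=> [|_ _ [u <- gu] [w <- gw]|_ [u <- gu]].
- by exists 1%g => //; exact: good1.
- by exists (u * w)%g; [exact/esym/Lambda_class_mulg | exact: goodM].
have [uS uu uVS] := hurwitzS_unitP u.
have N0 : Nrd (val u) != 0 by rewrite Nrd_rat_eq0 -quat_rat_unit.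
have NV : (Nrd (val u))^-1 = Nrd (val u)^-1.
  by apply: (mulfI N0); rewrite divff // -NrdM mulrV // Nrd1.
have NS : ZS_unit S (Nrd (val u)).
  by split; rewrite ?NV //; exact: hurwitzS_Nrd.
(* The inverse class is represented by conj(u) = Nrd(u) u^-1, which differs from u^-1 by the S-unit
   Nrd(u). *)
exists (to_hurwitzS_unit (hurwitzS_unitZ (u^-1)%g NS)).
  rewrite -[RHS]/(Lambda_inv _) Lambda_classV; apply/Lambda_classP.
  by exists (Nrd (val u)).
suff -> : val (to_hurwitzS_unit (hurwitzS_unitZ (u^-1)%g NS)) = quat_conj (val u).
  exact: good_conj.
rewrite -[LHS]/(Nrd (val u) *: (val u)^-1).
by rewrite -[RHS](mulrK uu) quat_conjM -scalerAl mul1r.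
Qed.

Lemma Gamma'_torsion_free g n : Gamma g -> (0 < n)%N -> (g ^+ n)%g = 1%g -> g = 1%g.
Proof.
move=> /Gamma'_good[u <- gu]; case: n => // n _.
have powE k : (Lambda_class u ^+ k)%g = Lambda_class (u ^+ k)%g.
  by elim: k => [|k IH] //; rewrite !expgS IH Lambda_class_mulg.
have valE k : val (u ^+ k)%g = val u ^+ k.
  by elim: k => [|k IH] //; rewrite expgS exprS -IH.
rewrite powE => /Lambda_classP[z _]; rewrite valE => e.
have [t ut] := good_torsion gu e; exact: Lambda_class_scalar ut.
Qed.

Variable phi : forall p : S0_prime S, {lrmorphism quat (Qp (val p)) -> 'M[Qp (val p)]_2}.
Local Notation vertices := (forall p : S0_prime S, set (set 'cV[Qp (val p)]_2)).
Variable v0 : vertices.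
Arguments v0 : clear implicits.
Hypothesis v0P : forall p, base_vertex_spec (phi p) (v0 p).

Let v0_vertex : cube_vertex v0. Proof. by move=> p; have [] := v0P p. Qed.

Lemma base_vertex_free (u : hurwitzS_unit S) :
  one_or_1jk_mod2 (val u) -> unit_act phi (val u) v0 = v0 -> Lambda_class u = 1%g.
Proof.
move=> gu fixu; have [n nE on] := good_Nrd gu.
case: gu => a [b [c [d uE]]].
have [A [B [C [E [uE' Aodd]]]]] : exists A B C E : int,
    val u = Quat A%:~R B%:~R C%:~R E%:~R /\ ~~ (2 %| A)%Z.
  exists (2 * a + 1), (2 * b), c, (c + 2 * d); split=> //.
  by apply/negP => /dvdzP[k]; lia.
pose m := gcdz A (gcdz B (gcdz C E)).
have A0 : A != 0 by apply: contra Aodd => /eqP ->; rewrite dvdz0.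
have m0 : m != 0 by rewrite gcdz_eq0 negb_and A0.
have [mA mBCE] : (m %| A)%Z /\ (m %| gcdz B (gcdz C E))%Z.
  by split; [exact: dvdz_gcdl | exact: dvdz_gcdr].
move: mBCE; rewrite !dvdz_gcd => /and3P[mB mC mE].
move: (mA) (mB) (mC) (mE).
move=> /dvdzP[A' AE] /dvdzP[B' BE] /dvdzP[C' CE] /dvdzP[E' EE].
pose x : D := Quat A'%:~R B'%:~R C'%:~R E'%:~R.
have ux : val u = m%:~R *: x.
  by rewrite uE' AE BE CE EE /x quatZE !intrM; congr Quat; rewrite mulrC.
have mq : m%:~R != 0 :> rat by rewrite intr_eq0.
have fixx : unit_act phi x v0 = v0.
  by rewrite -[RHS]fixu ux unit_actZ.
have [N NE] : exists N : nat, Nrd x = N%:R by apply: hurw_Nrd; exact: hurw_int_quat.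
have nmN : n = (`|m| ^ 2 * N)%N.
  have h : (n : int) = m ^+ 2 * N.
    apply: (@intr_inj rat); rewrite intrM rmorphXn -!pmulrn -nE ux NrdZ NE //.
  by rewrite -[n]/(`|n%:Z|%N) h abszM abszX.
have N0 : (0 < N)%N by case: N {NE} nmN on => [->|//]; rewrite muln0.
have N1 : N = 1%N.
  (* A prime factor q of N divides the norm of [val u], so it lies in S, and it is odd because n is.
     Since x fixes the base vertex at q, q divides its four coordinates, against the choice of [m]
     as their common divisor before division. *)
  apply/eqP; rewrite eqn_leq N0 andbT leqNgt; apply/negP => N1.
  pose q : prime_nat := exist (fun p => is_true (prime p)) (pdiv N) (pdiv_prime N1).
  have qN : (q %| N)%N by exact: pdiv_dvd.
  have qn : (q %| n)%N by rewrite nmN dvdn_mull.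
  have oq : odd q := dvdn_odd qn on.
  have [p pq] := S0_primeP (hurwitzS_unit_prime nE qn) oq.
  have [k Nk] := dvdnP qN.
  have k0 : (k : int) != 0 by apply: contraTneq N0 => -[k0]; rewrite Nk k0.
  have xN : Nrd x = ((val p)%:Z * k)%:~R by rewrite NE Nk pq mulnC pmulrn PoszM.
  have [_ _ /(_ A' B' C' E' k xN k0) h _] := v0P p.
  have [qA qB qC qE] := h (congr1 (fun v => v p) fixx).
  have dv (y y' : int) : ((val p)%:Z %| y')%Z -> y = y' * m -> (m * (val p)%:Z %| y)%Z.
    by move=> h' ->; rewrite mulrC dvdz_mul.
  have : (m * (val p)%:Z %| m)%Z.
    by rewrite !dvdz_gcd (dv _ _ qA AE) (dv _ _ qB BE) (dv _ _ qC CE) (dv _ _ qE EE).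
  rewrite -[X in (_ %| X)%Z]mulr1 dvdz_mul2l // dvdz1 /= => /eqP p1.
  by have := p_gt1 (val p); rewrite p1.
have sumN : A' ^+ 2 + B' ^+ 2 + C' ^+ 2 + E' ^+ 2 = 1.
  apply: (@intr_inj rat); transitivity (Nrd x); last by rewrite NE N1.
  by rewrite /x /Nrd /= -!rmorphXn -!intrD.
(* The odd real part excludes i, j, k and their opposites: of the Lipschitz units only 1 and -1
   remain. *)
have A'0 : A' != 0 by apply: contra A0; rewrite AE => /eqP ->; rewrite mul0r.
have A'1 : 0 < A' ^+ 2 by rewrite exprn_even_gt0.
have [B0 C0 E0] : [/\ B' = 0, C' = 0 & E' = 0].
  have h1 := sqr_ge0 B'; have h2 := sqr_ge0 C'; have h3 := sqr_ge0 E'.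
  have sq0 (y : int) : y ^+ 2 = 0 -> y = 0 by move/eqP; rewrite sqrf_eq0 => /eqP.
  by split; apply: sq0; move: sumN A'1 h1 h2 h3; clear; lia.
apply: (Lambda_class_scalar (t := (A' * m)%:~R)).
by rewrite uE' AE BE CE EE B0 C0 E0 !mul0r quat1E quatZE mulr1 mulr0.
Qed.

(** An element of the group imitates x on the base vertex at p without disturbing the base vertices
    at the other primes. *)
Definition reach (p : S0_prime S) (x : D) : Prop :=
  exists u : hurwitzS_unit S, [/\ Gamma (Lambda_class u),
    unit_act phi (val u) v0 p = unit_act phi x v0 p &
    forall q, q != p -> unit_act phi (val u) v0 q = v0 q].

(** Quaternions of norm 1 fix every base vertex and the scalar p acts trivially, so only the factors
    in A'_p contribute, and these are generators. *)
Lemma reach_prime_power (p : S0_prime S) m x :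
  x \in hurw -> Nrd x = (val p ^ m)%:R -> reach p x.
Proof.
have op := S0_prime_odd p; have [G1 GM _] := Gamma'_subgroup.
apply: (hurw_prime_power_ind (p_prime (val p)) (A := A'_set O2 (val p)) (P := reach p)).
- exact: (A'_set_adjust hO2 op).
- move=> e he e1; exists 1%g; split=> [//||q _]; rewrite unit_act1 //.
  have [_ h _ _] := v0P p; rewrite /unit_act (h e 1%N) // dvdn1.
  by have := p_gt1 (val p); case: eqP => // ->.
- move=> y _ [u [Gu uy uq]]; exists u; split; [exact: Gu | | exact: uq].
  have p0 : (val p)%:R != 0 :> rat by rewrite pnatr_eq0 -lt0n p_gt0.
  have := congr1 (fun v : vertices => v p) (unit_actZ phi y p0 v0_vertex).
  by cbv beta => e; rewrite uy; apply: esym; apply: e.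
move=> y z Ay hz [u [Gu uz uq]].
have [hy yN] := A'_set_hurw Ay.
have yU := hurw_hurwitzS_unit hy yN (S0_prime_number p).
pose y' := to_hurwitzS_unit yU.
exists (y' * u)%g; split.
- by rewrite -Lambda_class_mulg; apply: GM Gu; exact: (Gamma'_gen (p := p)).
- have -> : unit_act phi (y * z) v0 = unit_act phi y (unit_act phi z v0) by exact: unit_actM.
  rewrite unit_act_mulg; exact: (congr1 (GL2_act (phi p (quat_Qp (val p) y))) uz).
move=> q qp; rewrite unit_act_mulg.
have -> : unit_act phi y (unit_act phi (val u) v0) q = unit_act phi y v0 q.
  exact: (congr1 (GL2_act (phi q (quat_Qp (val q) y))) (uq q qp)).
have [_ h _ _] := v0P q; apply: (h y (val p) hy yN).
rewrite dvdn_prime2 ?p_prime //; apply: contra qp => /eqP e.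
Qed.

(** Induction on a list of primes outside of which w agrees with the base vertex. Applying u^-1
    corrects the component at p and fixes the base vertex at every other prime, so earlier agreement
    is kept. *)
Lemma base_vertex_transitive w : cube_vertex w ->
  exists2 u : hurwitzS_unit S, Gamma (Lambda_class u) & unit_act phi (val u) v0 = w.
Proof.
have [G1 GM _] := Gamma'_subgroup.
have [s sP] := S0_prime_enum S.
have : forall p, p \notin s -> w p = v0 p by move=> p; rewrite sP.
elim: s w {sP} => [|p s IH] w ws hw.
  exists 1%g => //; rewrite [LHS]unit_act1.
  by apply/functional_extensionality_dep => p; rewrite ws.
have [_ _ _ /(_ _ (hw p))[x [m [hx xN wp]]]] := v0P p.
have [u [Gu up uq]] := reach_prime_power hx xN.
have [_ uu _] := hurwitzS_unitP u; have uV : (val u)^-1 \is a GRing.unit by rewrite unitrV.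
have [|r Gr rE] := IH (unit_act phi (val u)^-1 w) _ (unit_act_vertex phi uV hw); last first.
  exists (u * r)%g; first by rewrite -Lambda_class_mulg; exact: GM.
  by rewrite unit_act_mulg rE -unit_actM (mulrV uu) unit_act1.
move=> q qs; rewrite {1}/unit_act; have -> : w q = unit_act phi (val u) v0 q.
  have [qp|qp] := eqVneq q p.
    by move: qs; rewrite qp => _; rewrite up; exact: wp.
  by rewrite (uq q qp); apply: ws; rewrite inE negb_or qp.
rewrite -[RHS](congr1 (fun v : vertices => v q) (unit_act1 phi v0)) -(mulVr uu).
by rewrite unit_actM.
Qed.

End GammaGroup.

(** * Elements mapping a cell to itself *)

Section FixedCells.
Variables (S : {fset place}).
Variable phi : forall p : S0_prime S, {lrmorphism quat (Qp (val p)) -> 'M[Qp (val p)]_2}.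
Local Notation vertices := (forall p : S0_prime S, set (set 'cV[Qp (val p)]_2)).
Local Notation cells := (forall p : S0_prime S, set (set (set 'cV[Qp (val p)]_2))).

(* F may swap the ends of an edge, but its square fixes them. *)
Lemma tree_cell_square (p : prime_nat) (F : set (set 'cV[Qp p]_2) -> set (set 'cV[Qp p]_2)) c :
  tree_cell c -> F @` c = c -> exists2 v, tree_vertex v & F (F v) = v.
Proof.
case=> [[v hv ->] e|[v [w [[hv hw _] ->]] e]].
  have fv : F v = v.
    by have : [set v] (F v) by rewrite -e; exists v.
  by exists v; rewrite ?fv.
have Fv : [set v; w] (F v) by rewrite -e; exists v => //; left.
have Fw : [set v; w] (F w) by rewrite -e; exists w => //; right.
case: Fv => [fv|fv]; first by exists v; rewrite ?fv.
case: Fw => [fw|fw]; first by exists v; rewrite ?fv.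
by exists w; rewrite ?fw.
Qed.

Lemma cube_cell_square g (c : cells) : cube_cell c -> Lambda_act_cell phi g c = c ->
  exists2 v : vertices, cube_vertex v & Lambda_act phi (g * g)%g v = v.
Proof.
move=> hc fixc; pose M p := phi p (quat_Qp (val p) (val (repr g))).
have ex p : exists2 v, tree_vertex v & GL2_act (M p) (GL2_act (M p) v) = v.
  apply: (tree_cell_square (hc p)); exact: (congr1 (fun c : cells => c p) fixc).
have ex2 p : exists v, tree_vertex v /\ GL2_act (M p) (GL2_act (M p) v) = v.
  by have [v hv e] := ex p; exists v.
pose v : vertices := fun p => projT1 (cid (ex2 p)).
have hv : cube_vertex v by move=> p; case: (projT2 (cid (ex2 p))).
exists v; first exact: hv.
rewrite (Lambda_actM phi g g hv); apply/functional_extensionality_dep => p.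
by case: (projT2 (cid (ex2 p))).
Qed.

End FixedCells.

Theorem theorem3p15
    (S : {fset place}) (hS : (ramified_places `<=` S)%fset)
    (O2 : set (quat (Qp prime2))) (hO2 : is_maximal_order O2)
    (phi : forall p : S0_prime S,
       {lrmorphism quat (Qp (val p)) -> 'M[Qp (val p)]_2})
    (hphi : forall p : S0_prime S, bijective (phi p)) :
  (forall g : Lambda S, Gamma' O2 g ->
     exists u : hurwitzS_unit S,
       [/\ Lambda_class u = g,
           lipschitz (val u) &
           cong_mod_2lipschitz (val u) 1 \/
           cong_mod_2lipschitz (val u) (1 + D_j + D_k)]) /\
  [/\ (forall v w : (forall p : S0_prime S, set (set 'cV[Qp (val p)]_2)),
         cube_vertex v -> cube_vertex w ->
         exists! g : Lambda S, Gamma' O2 g /\ Lambda_act phi g v = w),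
      (forall (g : Lambda S)
              (c : forall p : S0_prime S, set (set (set 'cV[Qp (val p)]_2))),
         Gamma' O2 g -> cube_cell c -> Lambda_act_cell phi g c = c ->
         g = 1%g) &
      (forall (g : Lambda S) (n : nat),
         Gamma' O2 g -> (0 < n)%N -> (g ^+ n)%g = 1%g -> g = 1%g)].
Proof.
split.
  move=> g /(Gamma'_good hO2)[u ug gu]; have [lu cu] := good_lipschitz gu.
  by exists u; split.
have [G1 GM GV] := Gamma'_subgroup S O2.
pose ex_v0 p := exists_base_vertex (S0_prime_odd p) (hphi p).
pose v0 p := projT1 (cid (ex_v0 p)).
have v0P p : base_vertex_spec (phi p) (v0 p) := projT2 (cid (ex_v0 p)).
have hv0 : cube_vertex v0 by move=> p; have [] := v0P p.
have act_u u : Lambda_act phi (Lambda_class u) v0 = unit_act phi (val u) v0.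
  exact: Lambda_act_unit.
have trans v : cube_vertex v ->
    exists2 g : Lambda S, Gamma' O2 g & Lambda_act phi g v0 = v.
  move=> hv; have [u Gu e] := base_vertex_transitive hO2 v0P hv.
  by exists (Lambda_class u); [exact: Gu | rewrite act_u].
(* Stabilisers of vertices are conjugate under the group by transitivity, which reduces the claim to
   the base vertex. *)
have free v g : cube_vertex v -> Gamma' O2 g -> Lambda_act phi g v = v -> g = 1%g.
  move=> hv Gg fixv; have [h Gh hE] := trans v hv.
  have Gk : Gamma' O2 (h^-1 * (g * h))%g.
    exact: (GM _ _ (GV _ Gh) (GM _ _ Gg Gh)).
  have k0 : Lambda_act phi (h^-1 * (g * h))%g v0 = v0.
    rewrite (Lambda_actM phi _ _ hv0) (Lambda_actM phi _ _ hv0) hE fixv -hE.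
    by rewrite -(Lambda_actM phi _ _ hv0) mulVg (Lambda_act1 phi hv0).
  have [u uk gu] := Gamma'_good hO2 Gk.
  have k1 : (h^-1 * (g * h))%g = 1%g.
    by rewrite -uk; apply: (base_vertex_free v0P gu); rewrite -act_u uk.
  have : (h * (h^-1 * (g * h)) * h^-1)%g = 1%g by rewrite k1 mulg1 mulgV.
  by rewrite mulVKg mulgK.
split.
- move=> v w hv hw; have [h Gh hE] := trans v hv; have [k Gk kE] := trans w hw.
  have hVv : Lambda_act phi h^-1%g v = v0.
    by rewrite -hE -(Lambda_actM phi _ _ hv0) mulVg (Lambda_act1 phi hv0).
  have act_kh : Lambda_act phi (k * h^-1)%g v = w.
    by rewrite (Lambda_actM phi _ _ hv) hVv.
  have Gkh : Gamma' O2 (k * h^-1)%g := GM _ _ Gk (GV _ Gh).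
  exists (k * h^-1)%g; split=> [|g [Gg gv]]; first by split.
  have : (g^-1 * (k * h^-1))%g = 1%g.
    apply: (free v _ hv (GM _ _ (GV _ Gg) Gkh)).
    rewrite (Lambda_actM phi _ _ hv) act_kh -gv -(Lambda_actM phi _ _ hv) mulVg.
    exact: Lambda_act1.
  by move=> e; rewrite -[LHS](mulVKg g) e mulg1.
(* Freeness on vertices gives g^2 = 1, and the absence of torsion then gives g = 1. *)
- move=> g c Gg hc fixc; have [v hv e] := cube_cell_square hc fixc.
  apply: (Gamma'_torsion_free hO2 (n := 2) Gg isT).
  exact: (free v _ hv (GM _ _ Gg Gg) e).
by move=> g n Gg n0 e; exact: (Gamma'_torsion_free hO2 Gg n0 e).
Qed.
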